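(* For $h\in\{1,2,3,4\}$ and $k\in\{0,1\}$ let \begin{align*} \mathcal{F}_k^{(1)}(q)&=q^{k}\frac{J_2^2}{J_4^3}\Big(\mathcal A_k(q^4)(J_{86,180}-q^{16}J_{14,180})-q^2\mathcal B_k(q^4)(J_{58,180}+q^{10}J_{22,180})\Big),\\ \mathcal{F}_k^{(2)}(q)&=q^{k-1}\frac{J_2^2}{J_4^3}\Big(\mathcal B_k(q^4)(J_{78,180}+q^6J_{42,180})-\mathcal A_k(q^4)(q^2J_{66,180}+q^{20}J_{6,180})\Big),\\ \mathcal{F}_k^{(3)}(q)&=q^k\frac{J_2^2}{J_4^3}\Big(\mathcal A_k(q^4)(-J_{74,180}+q^8J_{34,180})+\mathcal B_k(q^4)(q^6J_{38,180}+q^{20}J_{2,180})\Big),\\ \mathcal{F}_k^{(4)}(q)&=q^{k-1}\frac{J_2^2}{J_4^3}\Big(\mathcal A_k(q^4)(q^6J_{46,180}+q^{12}J_{26,180})-\mathcal B_k(q^4)(J_{82,180}+q^2J_{62,180})\Big). \end{align*} Then for $h=1,2,3,4$, $$M^{(h)}(q)=-\mathcal{F}_0^{(h)}(q)+\mathcal{F}_1^{(h)}(q)+2\,\mathrm{i}^{h-2}\Big(\mathrm{i}\,\mathcal{F}_0^{(h)}(\mathrm{i} q)+\mathcal{F}_1^{(h)}(\mathrm{i} q)\Big),$$ where $\mathrm{i}=\sqrt{-1}$.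
   Context: Throughout $0<|q|<1$. Notation: $(a;q)_n=\prod_{k=0}^{n-1}(1-aq^k)$, $(a;q)_\infty=\prod_{k\ge0}(1-aq^k)$, $(a_1,\dots,a_r;q)_\infty=\prod_s(a_s;q)_\infty$; $J_m:=(q^m;q^m)_\infty$ and $J_{a,m}:=(q^a,q^{m-a},q^m;q^m)_\infty$ (functions of $q$). Define $$M(u,v,w;q):=\sum_{i,j,k\geq 0}\frac{q^{i^2+2j^2+2k^2-2ij-2jk}u^iv^jw^k}{(q^4;q^4)_i(q^4;q^4)_j(q^4;q^4)_k}$$ (here $i,j,k$ are summation indices) and $M^{(1)}(q):=M(1,1,1;q)$, $M^{(2)}(q):=M(q^2,q^{-2},1;q)$, $M^{(3)}(q):=M(q^2,1,q^{-2};q)$, $M^{(4)}(q):=M(q^2,1,1;q)$. Define $$\mathcal A_0(q)=\sum_{n\ge0}\frac{q^{n^2}}{(q;q)_{2n}}=\frac{J_2J_{20}}{J_1J_{4,20}},\qquad \mathcal A_1(q)=\sum_{n\ge0}\frac{q^{n(n+1)}}{(q;q)_{2n+1}}=\frac{J_{3,10}J_{4,20}}{J_1J_{20}},$$ $$\mathcal B_0(q)=\sum_{n\ge0}\frac{q^{(n+1)^2}}{(q;q)_{2n+1}}=q\frac{J_2J_{20}}{J_1J_{8,20}},\qquad \mathcal B_1(q)=\sum_{n\ge0}\frac{q^{n(n+1)}}{(q;q)_{2n}}=\frac{J_{1,10}J_{8,20}}{J_1J_{20}}.$$ $\mathcal F(\mathrm{i}q)$ means that every occurrence of $q$ in $\mathcal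 F(q)$ (including inside $J_m$, $J_{a,m}$) is replaced by $\mathrm{i}q$. *)

(* Defs.v *)
From HB Require Import structures.
From mathcomp Require Import all_boot all_order all_algebra.
From mathcomp Require Import all_classical all_reals all_analysis.
From mathcomp Require Import complex.
From mathcomp.analysis.showcase Require summability.

Set Implicit Arguments.
Unset Strict Implicit.
Unset Printing Implicit Defensive.

Import Order.TTheory GRing.Theory Num.Theory.
Import numFieldNormedType.Exports.

Local Open Scope classical_set_scope.
Local Open Scope ring_scope.

(* The complex numbers are R[i] with R : realType; the alias R[i]^o (the same
   type) is what carries the norm topology in which limits are taken. *)

Definition qpoch (R : realType) (a q : R[i]) (n : nat) : R[i] :=
  \prod_(0 <= k < n) (1 - a * q ^+ k).

Definition qpoch_inf (R : realType) (a q : R[i]) : R[i] :=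
  limn (fun n => qpoch a q n : R[i]^o).

Definition J (R : realType) (m : nat) (q : R[i]) : R[i] :=
  qpoch_inf (q ^+ m) (q ^+ m).

(* Only used with a <= m, where the truncated subtraction m - a is exact. *)
Definition Ja (R : realType) (a m : nat) (q : R[i]) : R[i] :=
  qpoch_inf (q ^+ a) (q ^+ m) * qpoch_inf (q ^+ (m - a)) (q ^+ m)
    * qpoch_inf (q ^+ m) (q ^+ m).

Definition csum (R : realType) (u : nat -> R[i]) : R[i] :=
  limn (series u : nat -> R[i]^o).

(* [summability.sum] is the unordered sum: the limit of the partial sums over
   finite subsets of nat * nat * nat directed by inclusion.  The exponent of q
   is an int since it involves genuine subtractions. *)
Definition nahmM (R : realType) (u v w q : R[i]) : R[i] :=
  summability.sum (fun ijk : nat * nat * nat =>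
    let: (i, j, k) := ijk in
    (q ^ (i%:Z ^+ 2 + 2 * j%:Z ^+ 2 + 2 * k%:Z ^+ 2
            - 2 * i%:Z * j%:Z - 2 * j%:Z * k%:Z)
       * u ^+ i * v ^+ j * w ^+ k
     / (qpoch (q ^+ 4) (q ^+ 4) i * qpoch (q ^+ 4) (q ^+ 4) j
          * qpoch (q ^+ 4) (q ^+ 4) k) : R[i]^o)).

(* M^(h), meaningful for 1 <= h <= 4. *)
Definition Mh (R : realType) (h : nat) (q : R[i]) : R[i] :=
  match h with
  | 1 => nahmM 1 1 1 q
  | 2 => nahmM (q ^+ 2) (q ^- 2) 1 q
  | 3 => nahmM (q ^+ 2) 1 (q ^- 2) q
  | 4 => nahmM (q ^+ 2) 1 1 q
  | _ => 0
  end.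

(* A_k and B_k are meaningful for k = 0, 1; they are taken as the q-series,
   not as the infinite products those series are equal to. *)
Definition calA (R : realType) (k : nat) (q : R[i]) : R[i] :=
  match k with
  | 0 => csum (fun n => q ^+ (n ^ 2) / qpoch q q (2 * n))
  | 1 => csum (fun n => q ^+ (n * n.+1) / qpoch q q (2 * n + 1))
  | _ => 0
  end.

Definition calB (R : realType) (k : nat) (q : R[i]) : R[i] :=
  match k with
  | 0 => csum (fun n => q ^+ (n.+1 ^ 2) / qpoch q q (2 * n + 1))
  | 1 => csum (fun n => q ^+ (n * n.+1) / qpoch q q (2 * n))
  | _ => 0
  end.

(* F_k^(h), meaningful for 1 <= h <= 4 and k = 0, 1. *)
Definition calF (R : realType) (h k : nat) (q : R[i]) : R[i] :=
  let A := calA k (q ^+ 4) in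
  let B := calB k (q ^+ 4) in
  let c := J 2 q ^+ 2 / J 4 q ^+ 3 in
  match h with
  | 1 => q ^ k%:Z * c
         * (A * (Ja 86 180 q - q ^+ 16 * Ja 14 180 q)
            - q ^+ 2 * B * (Ja 58 180 q + q ^+ 10 * Ja 22 180 q))
  | 2 => q ^ (k%:Z - 1) * c
         * (B * (Ja 78 180 q + q ^+ 6 * Ja 42 180 q)
            - A * (q ^+ 2 * Ja 66 180 q + q ^+ 20 * Ja 6 180 q))
  | 3 => q ^ k%:Z * c
         * (A * (- Ja 74 180 q + q ^+ 8 * Ja 34 180 q)
            + B * (q ^+ 6 * Ja 38 180 q + q ^+ 20 * Ja 2 180 q))
  | 4 => q ^ (k%:Z - 1) * c
         * (A * (q ^+ 6 * Ja 46 180 q + q ^+ 12 * Ja 26 180 q)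
            - B * (Ja 82 180 q + q ^+ 2 * Ja 62 180 q))
  | _ => 0
  end.

(* Main.v *)
(* Write Q = q^4.  With a = i - j, b = j - k, c = k the summand is a Gaussian
   q^(a(a+2al) + b(b+2be) + c(c+2ga)) over (Q;Q)_i (Q;Q)_j (Q;Q)_k, with (al,be,ga) one
   of (0,0,0), (1,0,0), (1,1,0), (1,1,1).  Inserting (-1)^k or (-1)^j and summing over
   that index gives, by Euler, a product that vanishes for one parity of the remaining
   indices; this identifies most of the eight sums over parity classes of (i, j, k), and
   the rest are separated by comparing q with iq.  So everything reduces to the sum with
   sign (-1)^k and i of fixed parity.  There the sum over k is an Euler product, killing
   one parity of j, and the sum over i is E_n = sum_i q^((i+1-n)^2) / (Q;Q)_i with i of
   fixed parity, which satisfies E_(n+2) = E_(n+1) + Q^n E_n with initial values B_k and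
   A_k.  Schur's bosonic formula for that recurrence makes E_n, E_n Q^n, ... / (Q;Q)_(2m)
   a Bailey pair relative to 1, the remaining sum over m is the conjugate Bailey pair with
   parameter Q^(1/2), and Jacobi's triple product identifies the resulting theta series
   of modulus 180. *)

(* The four cases meet the same weight [(-1)^m q^(2m^2) (q^2;Q)_m / (Q;Q)_(2m)] and differ only in
   what it multiplies: E_(2m+1), E_(2m), (1 - Q^(2m)) E_(2m-1) and Q^m E_(2m) for h = 1, 2, 3, 4.
   Each of these is a sum over l of signed powers of q times Gaussian binomials [2m; m - r], and
   [2m; m - r] / (Q;Q)_(2m) = 1 / ((Q;Q)_(m-r) (Q;Q)_(m+r)) is the Bailey kernel. Here r is half of
   5l plus a constant, so only one parity of l counts; with l = 2n + eps the exponent 10 l^2 + 2 r^2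
   has leading term 40 n^2 + 50 n^2, whence the modulus 180. A_k and B_k appear linearly because any
   solution of the recurrence is E_1 times the solution starting with 0, 1 plus E_0 times the one
   starting with 1, 0. Replacing q by iq fixes Q and multiplies each summand of M by i to its
   exponent, which modulo 4 depends only on the parities of i, j, k. Both F(q) and F(iq) are
   therefore combinations of the same eight class sums, and the theorem becomes eight scalar
   identities. *)
Require Import Defs.
From mathcomp Require Import all_boot all_order all_algebra.
From mathcomp Require Import all_classical all_reals all_analysis.
From mathcomp Require Import complex.
From mathcomp Require Import finmap zify ring lra.
From mathcomp.analysis.showcase Require summability.

Set Implicit Arguments.
Unset Strict Implicit.
Unset Printing Implicit Defensive.

Import Order.TTheory GRing.Theory Num.Theory.
Import numFieldNormedType.Exports.
Local Open Scope ring_scope.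

(** * Unordered sums *)

Section UnorderedSums.
Context {R : realType}.
Local Notation C := R[i].

(** Convergence along finite subsets, kept as a relation: an identity is proved by evaluating one
    family in two ways and applying [has_sum_unique]. *)
Definition has_sum {T : choiceType} (f : T -> C) (s : C) :=
  forall e : C, 0 < e -> exists F0 : {fset T},
    forall F : {fset T}, (F0 `<=` F)%fset -> `|\sum_(x <- F) f x - s| <= e.

Definition abs_summable {T : choiceType} (f : T -> C) :=
  exists B : C, forall F : {fset T}, \sum_(x <- F) `|f x| <= B.

Lemma has_sum_sum {T : choiceType} (f : T -> C) (s : C) :
  has_sum f s -> summability.sum (f : T -> R[i]^o) = s.
Proof.
have FF := @summability.totally_filter T.
move=> fs; apply: cvg_lim => //.
apply/(@cvgrPdist_le _ _ _ _ (@summability.totally_filter T)) => e e0; have [F0 HF] := fs e e0.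
exists F0 => //= F F0F; rewrite distrC /summability.partial_sum.
by move: (HF F F0F); rewrite big_seq_fsetE.
Qed.

Lemma has_sum_unique {T : choiceType} (f : T -> C) (s t : C) :
  has_sum f s -> has_sum f t -> s = t.
Proof. by move=> /has_sum_sum <- /has_sum_sum. Qed.

Lemma has_sum_ext {T : choiceType} (f g : T -> C) (s : C) :
  f =1 g -> has_sum f s -> has_sum g s.
Proof. by move=> fg fs; rewrite (_ : g = f) //; apply/funext => x; rewrite fg. Qed.

Lemma abs_summable_ext {T : choiceType} (f g : T -> C) :
  f =1 g -> abs_summable f -> abs_summable g.
Proof. by move=> fg fs; rewrite (_ : g = f) //; apply/funext => x; rewrite fg. Qed.

Lemma has_sum0 {T : choiceType} : has_sum (fun _ : T => 0) 0.
Proof.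
move=> e e0; exists fset0 => F _.
by rewrite big1 ?subr0 ?normr0 ?ltW.
Qed.

Lemma has_sumD {T : choiceType} (f g : T -> C) (s t : C) :
  has_sum f s -> has_sum g t -> has_sum (fun x => f x + g x) (s + t).
Proof.
move=> fs gt e e0; have e20 : 0 < e / 2 by rewrite divr_gt0.
have [F1 H1] := fs _ e20; have [F2 H2] := gt _ e20.
exists (F1 `|` F2)%fset => F; rewrite fsubUset => /andP[S1 S2].
rewrite big_split /= opprD addrACA (splitr e).
by apply: le_trans (ler_normD _ _) _; rewrite lerD ?H1 ?H2.
Qed.

Lemma has_sumZ {T : choiceType} (k : C) (f : T -> C) (s : C) :
  has_sum f s -> has_sum (fun x => k * f x) (k * s).
Proof.
move=> fs e e0; have k0 : 0 < `|k| + 1 by rewrite ltr_wpDl.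
have [F0 HF] := fs _ (divr_gt0 e0 k0); exists F0 => F /HF.
rewrite -mulr_sumr -mulrBr normrM ler_pdivlMr // => H.
apply: le_trans H; rewrite mulrC ler_wpM2l // lerDl ler01 //.
Qed.

Lemma has_sumN {T : choiceType} (f : T -> C) (s : C) :
  has_sum f s -> has_sum (fun x => - f x) (- s).
Proof.
move=> /(has_sumZ (-1)); rewrite mulN1r; apply: has_sum_ext => x.
by rewrite mulN1r.
Qed.

Lemma has_sumB {T : choiceType} (f g : T -> C) (s t : C) :
  has_sum f s -> has_sum g t -> has_sum (fun x => f x - g x) (s - t).
Proof. by move=> fs /has_sumN; apply: has_sumD. Qed.

(** Serves for shifts of an index (with a vanishing first term), for restriction to one parity, and
    for passing from integers to naturals. *)
Lemma has_sum_inj {T U : choiceType} (h : T -> U) (f : U -> C) (s : C) :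
  injective h -> (forall u, (forall t, u <> h t) -> f u = 0) ->
  has_sum (fun t => f (h t)) s <-> has_sum f s.
Proof.
move=> hI f0.
have E (F : {fset U}) (G : {fset T}) : (h @` G `<=` F)%fset ->
    (forall t, h t \in F -> t \in G) ->
    \sum_(x <- F) f x = \sum_(t <- G) f (h t).
  move=> GF FG; rewrite -(big_fset_incl _ GF).
    by rewrite big_imfset //=; move=> x y _ _; exact: hI.
  move=> x xF xG; apply: f0 => t xt.
  by move: xG; rewrite xt in_imfset //= FG // -xt.
have preim (F : {fset U}) : exists G : {fset T}, forall t, (t \in G) = (h t \in F).
  have fin : finite_set (h @^-1` [set` F])%classic.
    apply: finite_preimage; last exact: finite_fset.
    by move=> x y _ _; exact: hI.
  by exists (fset_set (h @^-1` [set` F])%classic) => t; rewrite in_fset_set //= mem_setE.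
split=> fs e e0; have [F0 HF] := fs e e0.
  exists (h @` F0)%fset => F F0F.
  have [G GP] := preim F.
  rewrite (E F G); first apply: HF.
  - by apply/fsubsetP => t tF; rewrite GP (fsubsetP F0F) // in_imfset.
  - by apply/fsubsetP => _ /imfsetP[t /= tG ->]; rewrite -GP.
  - by move=> t; rewrite GP.
have [G GP] := preim F0.
exists G => F GF.
rewrite -(E (F0 `|` h @` F)%fset F); first by apply: HF; apply: fsubsetUl.
  exact: fsubsetUr.
move=> t; rewrite inE => /orP[|/imfsetP[t' /= t'F /hI ->]] //.
by rewrite -GP; apply/fsubsetP.
Qed.

Lemma has_sum_bij {T U : choiceType} (h : T -> U) (h' : U -> T) (f : U -> C) (s : C) :
  cancel h h' -> cancel h' h -> has_sum f s -> has_sum (fun t => f (h t)) s.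
Proof.
move=> hK h'K fs; apply/(has_sum_inj _ (can_inj hK)) => // u Hu.
by case: (Hu (h' u)).
Qed.

Lemma sum_fsetM {I J : choiceType} (A : {fset I}) (B : {fset J}) (f : I * J -> C) :
  \sum_(x <- (A `*` B)%fset) f x = \sum_(i <- A) \sum_(j <- B) f (i, j).
Proof.
rewrite -[RHS]big_allpairs; apply: perm_big; apply: uniq_perm.
- exact: fset_uniq.
- by apply: allpairs_uniq; rewrite ?fset_uniq //= => -[? ?] [? ?].
move=> [i j]; rewrite in_fsetM /=; apply/andP/allpairsP => [[iA jB]|].
  by exists (i, j).
by move=> [[i' j'] /= [? ? [-> ->]]].
Qed.

(** For a finite set F of rows, a large enough finite set H of columns makes each row sum over H
    accurate, and makes the rectangle F x H contain a set on which the double sum is already close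
    to s. *)
Lemma has_sum_pair {I J : choiceType} (f : I * J -> C) (g : I -> C) (s : C) :
  has_sum f s -> (forall i, has_sum (fun j => f (i, j)) (g i)) -> has_sum g s.
Proof.
move=> fs fg e e0; have e20 : 0 < e / 2 by rewrite divr_gt0.
have [F0 H0] := fs _ e20.
exists [fset x.1 | x in F0]%fset => F F0F.
(* The rows of F share the error e / 2; the successor avoids dividing by zero when F is empty. *)
pose d := e / 2 / (size F).+1%:R.
have d0 : 0 < d by rewrite divr_gt0.
have /choice[G HG] : forall i, exists G : {fset J}, forall H : {fset J},
    (G `<=` H)%fset -> `|\sum_(j <- H) f (i, j) - g i| <= d by move=> i; apply: fg.
pose H := ([fset x.2 | x in F0] `|` \bigcup_(i <- F) G i)%fset.
have F0FH : (F0 `<=` F `*` H)%fset.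
  apply/fsubsetP => -[i j] ijF0; rewrite in_fsetM /=; apply/andP; split.
    by apply: (fsubsetP F0F); apply/imfsetP; exists (i, j).
  by rewrite inE; apply/orP; left; apply/imfsetP; exists (i, j).
have := H0 _ F0FH; rewrite sum_fsetM => H1.
have -> : \sum_(i <- F) g i - s = (\sum_(i <- F) \sum_(j <- H) f (i, j) - s)
   - \sum_(i <- F) (\sum_(j <- H) f (i, j) - g i) by rewrite sumrB; ring.
rewrite (splitr e); apply: le_trans (ler_normB _ _) _; rewrite lerD //.
apply: le_trans (ler_norm_sum _ _ _) _.
apply: le_trans (_ : \sum_(i <- F) d <= _).
  rewrite !big_seq; apply: ler_sum => i iF; apply: HG.
  by rewrite fsubsetU // bigfcup_sup // orbT.
rewrite big_const_seq count_predT iter_addr_0.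
by rewrite -[leRHS](divfK (_ : (size F).+1%:R != 0)) ?pnatr_eq0 // mulr_natr ler_wpMn2l // ltW.
Qed.

Lemma le_sum_fsub {K : numDomainType} {T : choiceType} (f : T -> K) (F G : {fset T}) :
  (forall x, 0 <= f x) -> (F `<=` G)%fset -> \sum_(x <- F) f x <= \sum_(x <- G) f x.
Proof.
move=> f0 FG; rewrite (big_fsetID _ [pred x | x \in F] G) /=.
rewrite (_ : [fset x in G | x \in F]%fset = F); last first.
  apply/fsetP => x; rewrite !inE /= andbC; case xF: (x \in F) => //=.
  by rewrite (fsubsetP FG).
by rewrite lerDl sumr_ge0.
Qed.

Lemma nneg_has_sum {T : choiceType} (g : T -> R) (B : R) :
  (forall x, 0 <= g x) -> (forall F : {fset T}, \sum_(x <- F) g x <= B) ->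
  exists s, has_sum (fun x => (g x)%:C%C) s.
Proof.
move=> g0 gB; pose S := range (fun F : {fset T} => \sum_(x <- F) g x).
have supS : has_sup S.
  by split; [exists (\sum_(x <- fset0) g x); exists fset0 | exists B => _ [F _ <-]].
exists (sup S)%:C%C => e e0.
have [eR Ee] : 0 < complex.Re e /\ e = (complex.Re e)%:C%C.
  by move: e0; case: (e) => x y; rewrite ltcE /= => /andP[/eqP -> ->].
have [_ [F0 _ <-] HF0] := sup_adherent eR supS.
exists F0 => F F0F; rewrite Ee -rmorph_sum -rmorphB normc_def /= expr0n addr0.
rewrite sqrtr_sqr lecR ler_distl; apply/andP; split.
  by rewrite (le_trans (ltW HF0)) // le_sum_fsub.
have : \sum_(x <- F) g x <= sup S by apply: ub_le_sup; [exact: supS.2|exists F].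
by move=> /le_trans; apply; rewrite lerDl ltW.
Qed.

Lemma abs_summable_le {T : choiceType} (f g : T -> C) (k : C) :
  (forall x, `|f x| <= k * `|g x|) -> abs_summable g -> abs_summable f.
Proof.
move=> fg [B gB]; exists (`|k| * `|B|) => F.
apply: le_trans (_ : `|k| * \sum_(x <- F) `|g x| <= _).
  rewrite mulr_sumr; apply: ler_sum => x _; have := fg x => H.
  have k0 : 0 <= k * `|g x| by apply: le_trans H.
  by rewrite (le_trans H) // -[leLHS](ger0_norm k0) normrM normr_id.
apply: ler_wpM2l => //; rewrite (le_trans (gB F)) //.
by rewrite real_ler_norm // ger0_real // (le_trans _ (gB fset0)) // sumr_ge0.
Qed.

Lemma abs_has_sum {T : choiceType} (f : T -> C) :
  abs_summable f -> exists s, has_sum f s.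
Proof.
move=> [B fB].
have real_part (p : T -> R) : (forall x, `|p x|%:C%C <= `|f x|) ->
    exists s, has_sum (fun x => (p x)%:C%C) s.
  move=> pf.
  have pB (F : {fset T}) : \sum_(x <- F) `|p x| <= complex.Re B.
    have : (\sum_(x <- F) `|p x|)%:C%C <= B.
      by rewrite rmorph_sum (le_trans _ (fB F)) //; apply: ler_sum => x _; exact: pf.
    by rewrite lecE /= => /andP[].
  have [s1 H1] := nneg_has_sum (fun x => normr_ge0 (p x)) pB.
  (* A real family is the difference of the nonnegative families |p| + p and |p|. *)
  have [||s2 H2] := @nneg_has_sum _ (fun x => `|p x| + p x) (2 * complex.Re B).
  - by move=> x; rewrite -lerBlDr sub0r -normrN ler_norm.
  - move=> F; apply: le_trans (_ : \sum_(x <- F) 2 * `|p x| <= _).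
      by apply: ler_sum => x _; rewrite mulr_natl mulr2n lerD2l ler_norm.
    by rewrite -mulr_sumr ler_wpM2l.
  exists (s2 - s1); have := has_sumB H2 H1.
  by apply: has_sum_ext => x; rewrite rmorphD addrAC subrr add0r.
have [s1 H1] : exists s, has_sum (fun x => (complex.Re (f x))%:C%C) s.
  apply: real_part => x; case: (f x) => a b.
  rewrite normc_def lecR /= -(sqrtr_sqr a) ler_sqrt ?lerDl ?sqr_ge0 //.
  by rewrite addr_ge0 ?sqr_ge0.
have [s2 H2] : exists s, has_sum (fun x => (complex.Im (f x))%:C%C) s.
  apply: real_part => x; case: (f x) => a b.
  rewrite normc_def lecR /= -(sqrtr_sqr b) ler_sqrt ?lerDr ?sqr_ge0 //.
  by rewrite addr_ge0 ?sqr_ge0.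
exists (s1 + 'i%C * s2); have := has_sumD H1 (has_sumZ 'i%C H2).
by apply: has_sum_ext => x; rewrite -complexE.
Qed.

Lemma abs_summable_inj {T U : choiceType} (h : T -> U) (f : U -> C) :
  injective h -> abs_summable f -> abs_summable (fun t => f (h t)).
Proof.
move=> hI [B fB]; exists B => F; have := fB [fset h x | x in F]%fset.
by rewrite big_imfset //= => x y _ _; exact: hI.
Qed.

Lemma abs_summable_prod {I J : choiceType} (f : I -> C) (g : J -> C) :
  abs_summable f -> abs_summable g -> abs_summable (fun x => f x.1 * g x.2).
Proof.
move=> [A fA] [B gB]; exists (A * B) => F.
pose F1 := [fset x.1 | x in F]%fset; pose F2 := [fset x.2 | x in F]%fset.
have FF : (F `<=` F1 `*` F2)%fset.
  apply/fsubsetP => -[i j] ijF; rewrite in_fsetM /=; apply/andP; split;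
    by apply/imfsetP; exists (i, j).
apply: le_trans (le_sum_fsub (f := fun x => `|f x.1 * g x.2|) _ FF) _ => //.
rewrite sum_fsetM; have -> : \sum_(i <- F1) \sum_(j <- F2) `|f i * g j| =
    (\sum_(i <- F1) `|f i|) * \sum_(j <- F2) `|g j|.
  rewrite big_distrl /=; apply: eq_bigr => i _; rewrite big_distrr /=.
  by apply: eq_bigr => j _; rewrite normrM.
by apply: ler_pM => //; apply: sumr_ge0.
Qed.

(** Absolute summability supplies the existence of the double sum, and iterated summation then
    identifies its value. *)
Lemma has_sum_total {I J : choiceType} (f : I * J -> C) (g : I -> C) (s : C) :
  abs_summable f -> (forall i, has_sum (fun j => f (i, j)) (g i)) ->
  has_sum g s -> has_sum f s.
Proof.
move=> /abs_has_sum[t ft] fg gs.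
by rewrite (has_sum_unique gs (has_sum_pair ft fg)).
Qed.

Lemma has_sum_cvg (f : nat -> C) (s : C) :
  has_sum f s -> (series (f : nat -> R[i]^o) @ \oo --> (s : R[i]^o))%classic.
Proof.
move=> fs; apply/cvgrPdist_le => e e0.
have [F0 HF] := fs e e0; near=> n; rewrite distrC /series /=.
have -> : \sum_(0 <= k < n) f k = \sum_(k <- seq_fset tt (iota 0 n)) f k.
  rewrite /index_iota subn0; apply: perm_big.
  by rewrite perm_sym (perm_trans (seq_fset_perm _ _)) // undup_id // iota_uniq.
apply: HF; apply/fsubsetP => k kF0; rewrite seq_fsetE mem_iota add0n /=.
apply: leq_ltn_trans (_ : \sum_(k <- F0) k < n)%N.
  by rewrite (big_fsetD1 k) //= leq_addr.
by near: n; exact: nbhs_infty_gt.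
Unshelve. all: by end_near. Qed.

Lemma has_sum_series (f : nat -> C) (s : C) : has_sum f s -> csum f = s.
Proof.
move=> /has_sum_cvg fs; rewrite /csum.
exact: (@cvg_lim R[i]^o _ _ _ _ _ _ fs).
Qed.

Lemma abs_has_csum (f : nat -> C) : abs_summable f -> has_sum f (csum f).
Proof. by move=> /abs_has_sum[s fs]; rewrite (has_sum_series fs). Qed.

Lemma has_sum_eq {T : choiceType} (f g : T -> C) s t :
  has_sum f s -> f =1 g -> s = t -> has_sum g t.
Proof. by move=> fs /has_sum_ext fg <-; exact: fg. Qed.

Lemma has_sum_single {T : choiceType} (f : T -> C) t0 :
  (forall t, t != t0 -> f t = 0) -> has_sum f (f t0).
Proof.
move=> f0 e e0; exists [fset t0]%fset => F; rewrite fsub1set => F0.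
rewrite (big_fsetD1 t0) //= big_seq big1 ?addr0 ?subrr ?normr0 ?ltW // => k.
by rewrite !inE => /andP[/f0].
Qed.

Lemma has_sum_telescope (c : int -> C) : abs_summable c -> has_sum (fun l => c l - c (l + 1)) 0.
Proof.
move=> /abs_has_sum[s cs]; rewrite -(subrr s); apply: has_sumB => //.
exact: (has_sum_bij (addrK 1) (subrK 1) cs).
Qed.

Lemma has_sum_telescope_nat (g : nat -> C) : abs_summable g -> g 0%N = 0 ->
  has_sum (fun m => g m.+1 - g m) 0.
Proof.
move=> /abs_has_sum[s gs] g0; rewrite -(subrr s); apply: has_sumB => //.
by apply/(has_sum_inj _ succn_inj) => // -[//|n /(_ n)].
Qed.

Lemma norm_sum_le {T : choiceType} (f : T -> C) s B :
  has_sum f s -> (forall F : {fset T}, \sum_(x <- F) `|f x| <= B) -> `|s| <= B.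
Proof.
move=> fs fB; apply/ler_addgt0Pr => e e0.
have [F0 H] := fs e e0; have := H F0 (fsubset_refl _) => {H} H.
rewrite (_ : s = \sum_(x <- F0) f x - (\sum_(x <- F0) f x - s)); last by ring.
apply: le_trans (ler_normB _ _) _; apply: lerD H.
exact: le_trans (ler_norm_sum _ _ _) (fB F0).
Qed.

Lemma has_sum_prod {I J : choiceType} (f : I -> C) (g : J -> C) s t :
  abs_summable f -> abs_summable g -> has_sum f s -> has_sum g t ->
  has_sum (fun y : I * J => f y.1 * g y.2) (s * t).
Proof.
move=> af ag fs gt; apply: (has_sum_total (g := fun i => f i * t)).
- exact: abs_summable_prod.
- by move=> i; exact: (has_sumZ (f i) gt).
- by rewrite mulrC; apply: has_sum_ext (has_sumZ t fs) => i; rewrite mulrC.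
Qed.

End UnorderedSums.

(** * Summability of geometric and Gaussian series, and limits of power series at 0 *)

Section PowerSeries.
Context {R : realType}.
Local Notation C := R[i].
Implicit Types (a q x K : C).

Lemma exprn_eventually_le (x e : C) : 0 <= x -> x < 1 -> 0 < e ->
  exists N, forall n, (N <= n)%N -> x ^+ n <= e.
Proof.
move=> x0 x1 e0.
have [xr [xr0 xr1 ->]] : exists xr : R, [/\ 0 <= xr, xr < 1 & x = xr%:C%C].
  move: x0 x1; case: x => a b; rewrite lecE ltcE /= => /andP[/eqP -> a0] /andP[_ a1].
  by exists a.
have [er [er0 ->]] : exists er : R, 0 < er /\ e = er%:C%C.
  by move: e0; case: e => a b; rewrite ltcE /= => /andP[/eqP -> a0]; exists a.
have H : `|xr| < 1 by rewrite ger0_norm.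
have /cvgrPdist_le/(_ _ er0)[N _ HN] := cvg_expr H.
exists N => n /HN /=; rewrite sub0r normrN normrX ger0_norm // => le_er.
by rewrite -rmorphXn lecR.
Qed.

Lemma geo_sum_le x n : 0 <= x -> x < 1 -> \sum_(0 <= k < n) x ^+ k <= (1 - x)^-1.
Proof.
move=> x0 x1; have x1' : 0 < 1 - x by rewrite subr_gt0.
rewrite -(ler_pM2l x1') divff ?gt_eqF // big_mkord.
by rewrite -opprB mulNr -subrX1 opprB gerBl exprn_ge0.
Qed.

Lemma abs_summable_geo x : `|x| < 1 -> abs_summable (fun n : nat => x ^+ n).
Proof.
move=> x1; exists (1 - `|x|)^-1 => F.
apply: le_trans (geo_sum_le (\max_(k <- F) k).+1 _ x1) => //.
apply: le_trans (_ : \sum_(n <- F) `|x| ^+ n <= _).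
  by apply: ler_sum => n _; rewrite normrX.
rewrite [leRHS](_ : _ = \sum_(k <- seq_fset tt (iota 0 (\max_(k <- F) k).+1)) `|x| ^+ k).
  apply: le_sum_fsub => [n|]; first by rewrite exprn_ge0.
  apply/fsubsetP => k kF; rewrite seq_fsetE mem_iota add0n /= ltnS.
  by rewrite (big_fsetD1 k) //= leq_maxl.
rewrite /index_iota subn0; apply: perm_big.
by rewrite perm_sym (perm_trans (seq_fset_perm _ _)) // undup_id // iota_uniq.
Qed.

Lemma abs_summable_bin q K : `|q| < 1 ->
  abs_summable (fun n : nat => q ^+ 'C(n, 2) * K ^+ n).
Proof.
move=> q1; have K0 : 0 < 2 * (`|K| + 1) by rewrite mulr_gt0 // ltr_wpDl.
have [N HN] := exprn_eventually_le (normr_ge0 q) q1 (divr_gt0 ltr01 K0).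
(* The ratio g (n+1) / g n is 2 |q|^n |K|, at most 1 from N on. So g is bounded by the sum of its
   values up to N, and the series is dominated by a multiple of the geometric series of ratio
   1/2. *)
pose g n := `|q ^+ 'C(n, 2) * K ^+ n| * 2 ^+ n.
have g0 n : 0 <= g n by rewrite mulr_ge0 // exprn_ge0.
have gle n : g n <= \sum_(k < N.+1) g k.
  elim: n => [|n IHn].
    by rewrite big_ord_recl lerDl sumr_ge0.
  case: (leqP n.+1 N) => nN.
    by rewrite (bigD1 (Ordinal (nN : n.+1 < N.+1)%N)) //= lerDl sumr_ge0.
  apply: le_trans IHn; rewrite /g binS bin1 addnC exprD !exprS.
  rewrite [X in `|X| * _](_ : _ = (q ^+ 'C(n, 2) * K ^+ n) * (q ^+ n * K)); last by ring.
  rewrite normrM (_ : _ * (2 * 2 ^+ n) = (`|q ^+ 'C(n, 2) * K ^+ n| * 2 ^+ n) * (`|q ^+ n * K| * 2)); last by ring.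
  rewrite ler_piMr //; try exact: g0.
  rewrite normrM normrX; apply: le_trans (_ : (1 / (2 * (`|K| + 1))) * (`|K| + 1) * 2 <= _).
    rewrite ler_wpM2r //; apply: ler_pM => //; [exact: HN|by rewrite lerDl].
  by rewrite -mulrA [_ * 2]mulrC div1r mulVf ?gt_eqF.
have half : `|2^-1 : C| < 1 by rewrite ger0_norm ?invr_ge0 // invf_lt1 // ltr1n.
apply: abs_summable_le (abs_summable_geo half) => n.
rewrite [leRHS](_ : _ = (\sum_(k < N.+1) g k) / 2 ^+ n); last first.
  by rewrite ger0_norm ?exprn_ge0 ?invr_ge0 // exprVn.
by rewrite ler_pdivlMr ?exprn_gt0 //; exact: gle.
Qed.

Lemma cvg_pow0 q k : `|q| < 1 ->
  ((fun n => k * q ^+ n : R[i]^o) @ \oo --> (0 : R[i]^o))%classic.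
Proof.
move=> q1; apply/cvgrPdist_le => e e0.
have k0 : 0 < `|k| + 1 by rewrite ltr_wpDl.
have [N HN] := exprn_eventually_le (normr_ge0 q) q1 (divr_gt0 e0 k0).
exists N => // n /= /HN; rewrite ler_pdivlMr // => H.
rewrite sub0r normrN normrM normrX mulrC; apply: le_trans H.
by rewrite ler_wpM2l ?exprn_ge0 // lerDl.
Qed.

Lemma cvg_dist0 (u v : nat -> C) l : (forall n, `|u n - l| <= `|v n|) ->
  ((v : nat -> R[i]^o) @ \oo --> (0 : R[i]^o))%classic ->
  ((u : nat -> R[i]^o) @ \oo --> (l : R[i]^o))%classic.
Proof.
move=> uv /cvgrPdist_le v0; apply/cvgrPdist_le => e /v0 [N _ HN].
exists N => // n /HN /=; rewrite sub0r normrN distrC.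
by apply: le_trans; exact: uv.
Qed.

(** Every term but the constant one carries a factor q^n, so the distance to 1 is at most |q^n|
    times a fixed bound. This gives the limit at the end of an iterated q-difference equation. *)
Lemma cvg_powser (c : nat -> C) a q : `|q| < 1 -> c 0%N = 1 ->
  abs_summable (fun k => c k * a ^+ k) ->
  ((fun n => csum (fun k => c k * (a * q ^+ n) ^+ k) : R[i]^o) @ \oo --> (1 : R[i]^o))%classic.
Proof.
move=> q1 c0 ca.
have [B HB] : abs_summable (fun k => c k.+1 * a ^+ k.+1).
  by apply: (abs_summable_inj succn_inj ca).
apply: cvg_dist0 (cvg_pow0 B q1) => n.
have cn : abs_summable (fun k => c k * (a * q ^+ n) ^+ k).
  apply: (abs_summable_le (k := 1) _ ca) => k.
  rewrite exprMn mulrA normrM mulrC; apply: ler_wpM2r => //.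
  by rewrite !normrX !exprn_ile1 // ltW.
rewrite normrM; apply: norm_sum_le => [|F].
  apply/(has_sum_inj (f := fun k => (k != 0%N)%:R * (c k * (a * q ^+ n) ^+ k)) _ succn_inj).
    by case=> [_|k /(_ k)//]; rewrite mul0r.
  have := has_sumB (abs_has_csum cn) (_ : has_sum (fun k => (k == 0)%:R) 1).
  move=> /(_ _)/(has_sum_ext _); apply.
    by case=> [|k] /=; rewrite ?mul0r ?mul1r ?subr0 // c0 expr0 mulr1 subrr.
  move=> e e0; exists [fset 0%N]%fset => F; rewrite fsub1set => F0.
  rewrite (big_fsetD1 0%N) //= big_seq big1 ?addr0 ?subrr ?normr0 ?ltW // => k.
  by rewrite !inE => /andP[/negPf ->].
have B0 : 0 <= B by apply: le_trans (HB fset0); rewrite sumr_ge0.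
rewrite (ger0_norm B0); apply: le_trans (_ : `|q ^+ n| * \sum_(k <- F) `|c k.+1 * a ^+ k.+1| <= _).
  rewrite mulr_sumr; apply: ler_sum => k _; set w := q ^+ n.
  rewrite [leLHS](_ : _ = `|w| * `|c k.+1 * a ^+ k.+1| * `|w ^+ k|); last first.
    by rewrite -!normrM exprMn !exprS; rewrite /= mul1r; congr (`|_|); ring.
  by rewrite ler_piMr ?mulr_ge0 // !normrX !exprn_ile1 // ltW.
by rewrite mulrC; apply: ler_wpM2r.
Qed.

End PowerSeries.

(** * q-Pochhammer symbols and Euler's identities *)

Section QPochhammer.
Context {R : realType}.
Local Notation C := R[i].
Implicit Types (a q x : C).

Lemma qpoch0 a q : qpoch a q 0 = 1.
Proof. by rewrite /qpoch big_nil. Qed.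

Lemma qpochSr a q n : qpoch a q n.+1 = qpoch a q n * (1 - a * q ^+ n).
Proof. by rewrite /qpoch big_nat_recr. Qed.

Lemma qpochD a q m n : qpoch a q (m + n) = qpoch a q m * qpoch (a * q ^+ m) q n.
Proof.
elim: n => [|n IHn]; first by rewrite addn0 qpoch0 mulr1.
by rewrite addnS !qpochSr IHn exprD; ring.
Qed.

Lemma one_sub_neq0 x : `|x| < 1 -> 1 - x != 0.
Proof. by apply: contraTneq => /subr0_eq <-; rewrite normr1 ltxx. Qed.

Lemma norm_pow_lt1 q n : `|q| < 1 -> `|q ^+ n.+1| < 1.
Proof. by move=> q1; rewrite normrX exprn_ilt1. Qed.

Lemma qpochqq_neq0 q n : `|q| < 1 -> qpoch q q n != 0.
Proof.
move=> q1; elim: n => [|n IHn]; first by rewrite qpoch0 oner_neq0.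
by rewrite qpochSr mulf_neq0 // -exprS one_sub_neq0 // norm_pow_lt1.
Qed.

(** The modulus of the product is at least the product of the 1 - |q|^(k+1). Beyond a suitable M the
    inequality prod (1 - x_k) >= 1 - sum x_k keeps the tail above 1/2, so every product is at least
    half of the one up to M. *)
Lemma qpochqq_inv_bounded q : `|q| < 1 ->
  exists2 K : C, 0 < K & forall n, `|(qpoch q q n)^-1| <= K.
Proof.
move=> q1; have [x [x0 x1 xq]] : exists x, [/\ 0 <= x, x < 1 & x = `|q|] by exists `|q|.
pose P m n := \prod_(m <= k < n) (1 - x ^+ k.+1).
have f01 k : 0 < 1 - x ^+ k.+1 <= 1.
  by rewrite subr_gt0 exprn_ilt1 //= gerBl exprn_ge0.
have P01 m n : 0 < P m n <= 1.
  apply: (big_ind (fun y => 0 < y <= 1)) => [|y z /andP[y0 y1] /andP[z0 z1]|//].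
    by rewrite ltr01 lexx.
  by rewrite mulr_gt0 // mulr_ile1 // ltW.
have e0 : 0 < (1 - x) / 2 by rewrite divr_gt0 // subr_gt0.
have [M HM] := exprn_eventually_le x0 x1 e0.
have weier n : 1 - \sum_(M <= k < M + n) x ^+ k.+1 <= P M (M + n)%N.
  elim: n => [|n IHn]; first by rewrite addn0 /P !big_geq // subr0.
  rewrite /P addnS !big_nat_recr ?leq_addr //= -/(P M (M + n)%N).
  rewrite mulrBr mulr1 opprD addrA lerB // ler_piMl ?exprn_ge0 //.
  by case/andP: (P01 M (M + n)%N).
have tail n : 2^-1 <= P M (M + n)%N.
  apply: le_trans (weier n).
  have -> : \sum_(M <= k < M + n) x ^+ k.+1 = x ^+ M.+1 * \sum_(0 <= i < n) x ^+ i.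
    rewrite -{1}(add0n M) big_addn addKn mulr_sumr; apply: eq_bigr => i _.
    by rewrite -exprD addSn addnC.
  rewrite lerBrDl -lerBrDr (_ : 1 - 2^-1 = 2^-1); last by field.
  apply: le_trans (_ : (1 - x) / 2 * (1 - x)^-1 <= _).
    apply: ler_pM; rewrite ?exprn_ge0 //.
    - by rewrite sumr_ge0 // => i _; rewrite exprn_ge0.
    - exact: HM _ (leqnSn M).
    - exact: geo_sum_le.
  by rewrite mulrAC divff ?mul1r // subr_eq0 eq_sym lt_eqF.
have lb n : P 0%N M / 2 <= P 0%N n.
  have [/andP[PM0 PM1] /andP[Pn0 Pn1]] := (P01 0%N M, P01 0%N n).
  case: (leqP n M) => nM.
    rewrite (_ : P 0%N M = P 0%N n * P n M); last by rewrite /P -big_cat_nat.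
    rewrite -mulrA ler_piMr ?(ltW Pn0) //; have /andP[a0 a1] := P01 n M.
    by rewrite mulr_ile1 ?(ltW a0) // ?invr_ge0 // invf_le1 // ler1n.
  rewrite (_ : P 0%N n = P 0%N M * P M n); last by rewrite /P -big_cat_nat // ltnW.
  by rewrite ler_wpM2l ?(ltW PM0) // -(subnKC (ltnW nM)).
have /andP[PM0 PM1] := P01 0%N M.
exists (P 0%N M / 2)^-1 => [|n]; first by rewrite invr_gt0 divr_gt0.
rewrite normfV lef_pV2 ?posrE ?divr_gt0 ?normr_gt0 ?qpochqq_neq0 //.
apply: le_trans (lb n) _; rewrite /P /qpoch normr_prod; apply: ler_prod => k _.
case/andP: (f01 k) => a0 _; rewrite (ltW a0) /= -exprS xq -normrX.
by rewrite -{1}(normr1 C) lerB_dist.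
Qed.

Lemma abs_euler a q : `|q| < 1 ->
  abs_summable (fun k : nat => (-1) ^+ k * q ^+ 'C(k, 2) * a ^+ k / qpoch q q k).
Proof.
move=> q1; have [K K0 HK] := qpochqq_inv_bounded q1.
apply: (abs_summable_le (k := K) _ (abs_summable_bin a q1)) => k.
rewrite normrM -mulrA normrM normrX normrN1 expr1n mul1r mulrC.
exact: ler_wpM2r.
Qed.

Lemma abs_euler_inv x q : `|q| < 1 -> `|x| < 1 ->
  abs_summable (fun k : nat => x ^+ k / qpoch q q k).
Proof.
move=> q1 x1; have [K K0 HK] := qpochqq_inv_bounded q1.
apply: (abs_summable_le (k := K) _ (abs_summable_geo x1)) => k.
rewrite normrM mulrC; exact: ler_wpM2r.
Qed.

(** [qpoch a q n] equals E 0 / E n only eventually, since E n is known to be nonzero only near its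
    limit 1. *)
Lemma cvg_qpoch_ratio (E : nat -> C) a q :
  (forall n, E 0%N = qpoch a q n * E n) ->
  ((E : nat -> R[i]^o) @ \oo --> (1 : R[i]^o))%classic ->
  ((qpoch a q : nat -> R[i]^o) @ \oo --> (E 0%N : R[i]^o))%classic.
Proof.
move=> HE E1.
have H : ((fun n => E 0%N * (E n)^-1 : R[i]^o) @ \oo --> (E 0%N * 1^-1 : R[i]^o))%classic.
  by apply: cvgM; [exact: cvg_cst | apply: cvgV => //; exact: oner_neq0].
rewrite invr1 mulr1 in H.
apply: cvg_trans H; apply: near_eq_cvg.
have /cvgrPdist_lt/(_ 1 ltr01) := E1; apply: filterS => n /= E1n.
rewrite (HE n) mulfK //; apply: contraTneq E1n => ->.
by rewrite subr0 normr1 ltxx.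
Qed.

(** In E(a) - E(aq) the k-th coefficient gains the factor 1 - q^k, which cancels the last factor of
    (q;q)_k; shifting k by one leaves -a E(aq). *)
Lemma euler_step a q : `|q| < 1 ->
  csum (fun k : nat => (-1) ^+ k * q ^+ 'C(k, 2) * a ^+ k / qpoch q q k) =
  (1 - a) * csum (fun k : nat => (-1) ^+ k * q ^+ 'C(k, 2) * (a * q) ^+ k / qpoch q q k).
Proof.
move=> q1; set s := csum _; set t := csum _.
have Hs : has_sum _ s := abs_has_csum (abs_euler a q1).
have Ht : has_sum _ t := abs_has_csum (abs_euler (a * q) q1).
apply/eqP; rewrite -subr_eq0; apply/eqP.
have -> : s - (1 - a) * t = (s - t) - (- a) * t by ring.
apply/eqP; rewrite subr_eq0; apply/eqP.
apply: has_sum_unique (has_sumB Hs Ht) _.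
apply/(has_sum_inj _ succn_inj).
  by case=> [_|k /(_ k)//]; rewrite !expr0 !mulr1 subrr.
apply: has_sum_ext (has_sumZ (- a) Ht) => k.
have qk : qpoch q q k != 0 by rewrite qpochqq_neq0.
have qk1 : 1 - q * q ^+ k != 0 by rewrite -exprS one_sub_neq0 // norm_pow_lt1.
rewrite qpochSr binS bin1 exprD !exprS !exprMn; field.
by rewrite qk qk1.
Qed.

Lemma euler_qpoch a q n : `|q| < 1 ->
  csum (fun k : nat => (-1) ^+ k * q ^+ 'C(k, 2) * a ^+ k / qpoch q q k) =
  qpoch a q n * csum (fun k : nat => (-1) ^+ k * q ^+ 'C(k, 2) * (a * q ^+ n) ^+ k / qpoch q q k).
Proof.
move=> q1; pose E x := csum (fun k : nat => (-1) ^+ k * q ^+ 'C(k, 2) * x ^+ k / qpoch q q k).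
have ES x : E x = (1 - x) * E (x * q) by exact: euler_step.
rewrite -/(E a) -/(E (a * q ^+ n)); move: E ES => E ES.
elim: n => [|n ->]; first by rewrite qpoch0 mul1r expr0 mulr1.
by rewrite qpochSr exprSr (mulrA a) -(mulrA (qpoch a q n)) -ES.
Qed.

Lemma cvg_qpoch_csum a q : `|q| < 1 ->
  ((qpoch a q : nat -> R[i]^o) @ \oo -->
   (csum (fun k : nat => (-1) ^+ k * q ^+ 'C(k, 2) * a ^+ k / qpoch q q k) : R[i]^o))%classic.
Proof.
move=> q1.
pose E n := csum (fun k : nat => (-1) ^+ k * q ^+ 'C(k, 2) * (a * q ^+ n) ^+ k / qpoch q q k).
have E0 : E 0%N = csum (fun k : nat => (-1) ^+ k * q ^+ 'C(k, 2) * a ^+ k / qpoch q q k).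
  by rewrite /E expr0 mulr1.
rewrite -E0; apply: cvg_qpoch_ratio => [n|]; first by rewrite E0 (euler_qpoch _ n).
pose c k : C := (-1) ^+ k * q ^+ 'C(k, 2) / qpoch q q k.
have cE x k : c k * x ^+ k = (-1) ^+ k * q ^+ 'C(k, 2) * x ^+ k / qpoch q q k.
  by rewrite /c mulrAC.
rewrite (_ : E = fun n => csum (fun k => c k * (a * q ^+ n) ^+ k)); last first.
  by apply/funext => n; rewrite /E; congr (csum _); apply/funext => k; rewrite cE.
have c0 : c 0%N = 1 by rewrite /c qpoch0 divr1 bin_small // !expr0 mulr1.
apply: (cvg_powser (c := c) q1 c0).
by apply: abs_summable_ext (abs_euler a q1) => k; rewrite cE.
Qed.

Lemma qpoch_infE a q : `|q| < 1 ->
  qpoch_inf a q = csum (fun k : nat => (-1) ^+ k * q ^+ 'C(k, 2) * a ^+ k / qpoch q q k).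
Proof.
by move=> q1; have := cvg_qpoch_csum (a := a) q1; exact: (@cvg_lim R[i]^o).
Qed.

Lemma cvg_qpoch a q : `|q| < 1 ->
  ((qpoch a q : nat -> R[i]^o) @ \oo --> (qpoch_inf a q : R[i]^o))%classic.
Proof. by move=> q1; rewrite qpoch_infE //; exact: cvg_qpoch_csum. Qed.

Lemma euler a q : `|q| < 1 ->
  has_sum (fun k : nat => (-1) ^+ k * q ^+ 'C(k, 2) * a ^+ k / qpoch q q k) (qpoch_inf a q).
Proof. by move=> q1; rewrite qpoch_infE //; apply: abs_has_csum; exact: abs_euler. Qed.

Lemma qpoch_infD a q n : `|q| < 1 -> qpoch_inf a q = qpoch a q n * qpoch_inf (a * q ^+ n) q.
Proof. by move=> q1; rewrite !qpoch_infE // -euler_qpoch. Qed.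

Lemma qpoch_inf_eq0 a q n : `|q| < 1 -> a * q ^+ n = 1 -> qpoch_inf a q = 0.
Proof. by move=> q1 an; rewrite (qpoch_infD _ n.+1) // qpochSr an subrr mulr0 mul0r. Qed.

Lemma qpoch_inf_mul (F : nat -> C) a q : `|q| < 1 ->
  (forall n, F n = qpoch a q n * F 0%N) ->
  ((F : nat -> R[i]^o) @ \oo --> (1 : R[i]^o))%classic -> qpoch_inf a q * F 0%N = 1.
Proof.
move=> q1; move: (F 0%N) => f0 /funext FE F1.
have H : ((fun n => qpoch a q n * f0 : R[i]^o) @ \oo --> (qpoch_inf a q * f0 : R[i]^o))%classic.
  by apply: (cvgM (cvg_qpoch q1)); exact: cvg_cst.
rewrite FE in F1; exact: (@cvg_unique R[i]^o _ _ _ _ _ H F1).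
Qed.

(** Written as a product equal to 1 rather than as an inverse, so that the nonvanishing of the
    infinite product is a consequence and not a hypothesis. *)
Lemma euler_inv x q : `|q| < 1 -> `|x| < 1 ->
  exists2 s, has_sum (fun k : nat => x ^+ k / qpoch q q k) s & qpoch_inf x q * s = 1.
Proof.
move=> q1 x1.
pose F n := csum (fun k : nat => (x * q ^+ n) ^+ k / qpoch q q k).
have xn n : `|x * q ^+ n| < 1.
  rewrite normrM (le_lt_trans _ x1) // ler_piMr // normrX exprn_ile1 // ltW //.
have FS n : F n.+1 = (1 - x * q ^+ n) * F n.
  have Hs : has_sum _ (F n) := abs_has_csum (abs_euler_inv q1 (xn n)).
  have Ht : has_sum _ (F n.+1) := abs_has_csum (abs_euler_inv q1 (xn n.+1)).
  apply/eqP; rewrite mulrBl mul1r -subr_eq0 opprB addrCA -opprB subr_eq0.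
  apply/eqP; apply/esym; apply: has_sum_unique (has_sumB Hs Ht) _.
  apply/(has_sum_inj _ succn_inj).
    by case=> [_|k /(_ k)//]; rewrite !expr0 subrr.
  apply: has_sum_ext (has_sumZ (x * q ^+ n) Hs) => k.
  have qk : qpoch q q k != 0 by rewrite qpochqq_neq0.
  have qk1 : 1 - q * q ^+ k != 0 by rewrite -exprS one_sub_neq0 // norm_pow_lt1.
  rewrite (_ : x * q ^+ n.+1 = x * q ^+ n * q); last by rewrite exprSr mulrA.
  rewrite qpochSr; set y := x * q ^+ n; rewrite [(y * q) ^+ _]exprMn !exprS.
  by field; rewrite qk qk1.
have FE n : F n = qpoch x q n * F 0%N.
  elim: n => [|n IHn]; first by rewrite qpoch0 mul1r.
  by rewrite FS IHn qpochSr mulrCA mulrA.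
exists (F 0%N).
  by rewrite /F expr0 mulr1; apply: abs_has_csum; exact: abs_euler_inv.
have H1 : ((F : nat -> R[i]^o) @ \oo --> (1 : R[i]^o))%classic.
  rewrite (_ : F = fun n => csum (fun k => (qpoch q q k)^-1 * (x * q ^+ n) ^+ k)); last first.
    by apply/funext => n; rewrite /F; congr (csum _); apply/funext => k; rewrite mulrC.
  apply: cvg_powser => //; first by rewrite qpoch0 invr1.
  by apply: abs_summable_ext (abs_euler_inv q1 x1) => k; rewrite mulrC.
exact: qpoch_inf_mul q1 FE H1.
Qed.

Lemma qpoch_inf_qq_neq0 q : `|q| < 1 -> qpoch_inf q q != 0.
Proof.
move=> q1; have [s _ Hs] := euler_inv q1 q1.
by apply: contra_eq_neq Hs => ->; rewrite mul0r eq_sym oner_neq0.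
Qed.

End QPochhammer.

(** * Jacobi's triple product *)

Section TripleProduct.
Context {R : realType}.
Local Notation C := R[i].
Implicit Types (q x p : C).

Lemma abs_summable_bool (g : bool -> C) : abs_summable g.
Proof.
exists (`|g true| + `|g false|) => F.
apply: le_trans (le_sum_fsub (G := [fset true; false]%fset) (fun b => normr_ge0 (g b)) _) _.
  by apply/fsubsetP => -[] _; rewrite !inE.
by rewrite big_fsetU1 ?inE //= big_seq_fset1.
Qed.

Lemma abs_summable_int (f : nat -> C) :
  abs_summable f -> abs_summable (fun n : int => f `|n|%N).
Proof.
move=> af; have I : injective (fun n : int => (`|n|%N, n < 0)) by move=> m n []; lia.
have := abs_summable_inj I (abs_summable_prod af (abs_summable_bool (fun=> 1))).
by apply: abs_summable_ext => n; rewrite mulr1.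
Qed.

Lemma norm_exprz x (n : int) : `|x ^ n| = `|x| ^ n.
Proof. by case: n => n; rewrite ?NegzE -?exprnN ?normfV normrX. Qed.

Lemma abs_summable_gauss q x : `|q| < 1 ->
  abs_summable (fun n : int => q ^ (n * n) * x ^ n).
Proof.
move=> q1; have q21 : `|q ^+ 2| < 1 by exact: norm_pow_lt1.
(* Bounds both x and 1/x, so |x^n| <= K^|n| for either sign of n, and n^2 = 2 C(|n|, 2) + |n|
   reduces the claim to [abs_summable_bin]. *)
pose K : C := `|x| + `|x^-1|.
apply: (abs_summable_le (k := 1) _ (abs_summable_int (abs_summable_bin (K * q) q21))) => n.
rewrite mul1r (_ : n * n = (`|n| * `|n|)%N); last by lia.
rewrite -exprnP (_ : (`|n| * `|n| = 2 * 'C(`|n|, 2) + `|n|)%N); last first.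
  by elim: `|n|%N => // m IHm; rewrite binS bin1; nia.
rewrite exprD exprM [(K * q) ^+ _]exprMn [K ^+ `|n|%N * _]mulrC mulrA normrM [leRHS]normrM.
apply: ler_wpM2l => //; rewrite [leRHS]ger0_norm; last by rewrite exprn_ge0 // addr_ge0.
case: n => n /=; rewrite ?NegzE -?exprnN ?abszN; last rewrite -exprVn;
  by rewrite normrX lerXn2r ?nnegrE ?addr_ge0 // ?lerDl ?lerDr.
Qed.

Lemma expr_bin2 p m : p != 0 -> (p ^+ 2) ^+ 'C(m, 2) = p ^ (m%:Z * m%:Z - m%:Z).
Proof.
move=> p0; rewrite -exprM exprnP; congr (_ ^ _).
by elim: m => // m IHm; rewrite binS bin1; lia.
Qed.

(* (p^(2n+2); p^2)_inf vanishes for n < 0, so summing it against x^n over all integers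
   gives (p^2;p^2)_inf (x;p^2)_inf by Euler; expanding it by Euler instead and shifting n
   factors the double sum as the theta series over (p^2/x; p^2)_inf. *)
Lemma jacobi_triple p x : p != 0 -> `|p| < 1 -> x != 0 -> `|p ^+ 2 / x| < 1 ->
  has_sum (fun n : int => (-1) ^ n * p ^ (n * n - n) * x ^ n)
    (qpoch_inf x (p ^+ 2) * qpoch_inf (p ^+ 2 / x) (p ^+ 2) * qpoch_inf (p ^+ 2) (p ^+ 2)).
Proof.
move=> p0 p1 x0 px1; have p21 : `|p ^+ 2| < 1 by exact: norm_pow_lt1.
have aT : abs_summable (fun n : int => (-1) ^ n * p ^ (n * n - n) * x ^ n).
  apply: abs_summable_ext (abs_summable_gauss (- p^-1 * x) p1) => n.
  by rewrite -[- p^-1]mulN1r !expfzMl expfzDr // exprz_inv; ring.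
have [theta thetaP] := abs_has_sum aT.
have [s sP sE] := euler_inv p21 px1.
have H := has_sum_prod aT (abs_euler_inv p21 px1) thetaP sP.
have bij1 : cancel (fun y : int * nat => (y.1 + y.2%:Z, y.2)) (fun y => (y.1 - y.2%:Z, y.2)).
  by move=> [n m] /=; rewrite addrK.
have bij2 : cancel (fun y : int * nat => (y.1 - y.2%:Z, y.2)) (fun y => (y.1 + y.2%:Z, y.2)).
  by move=> [n m] /=; rewrite subrK.
have {}H := has_sum_bij bij1 bij2 H.
pose a (n : int) := (-1) ^ n * p ^ (n * n - n) * x ^ n * qpoch_inf (p ^ (2 * n + 2)) (p ^+ 2).
have /(has_sum_pair H) H2 : forall n, has_sum (fun m : nat =>
    (-1) ^ (n + m%:Z) * p ^ ((n + m%:Z) * (n + m%:Z) - (n + m%:Z)) * x ^ (n + m%:Z) *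
    ((p ^+ 2 / x) ^+ m / qpoch (p ^+ 2) (p ^+ 2) m)) (a n).
  move=> n; apply: has_sum_ext (has_sumZ _ (euler (p ^ (2 * n + 2)) p21)) => m.
  rewrite expr_bin2 // !(expfzDr n) ?oppr_eq0 ?oner_eq0 // -!exprnP [(p ^+ 2 / x) ^+ m]exprMn.
  rewrite exprVn (_ : p ^ ((n + m%:Z) * (n + m%:Z) - (n + m%:Z)) =
    p ^ (n * n - n) * p ^ (m%:Z * m%:Z - m%:Z) * p ^ (2 * n * m%:Z)); last first.
    by rewrite -!expfzDr //; congr (_ ^ _); ring.
  rewrite (_ : (p ^ (2 * n + 2)) ^+ m = p ^ (2 * n * m%:Z) * (p ^+ 2) ^+ m); last first.
    by rewrite -exprM !exprnP exprz_exp -expfzDr //; congr (_ ^ _); lia.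
  field; rewrite ?x0 ?expf_neq0 ?qpochqq_neq0 //.
have H3 : has_sum a (qpoch_inf (p ^+ 2) (p ^+ 2) * qpoch_inf x (p ^+ 2)).
  apply/(has_sum_inj (h := Posz)) => [|n Hn|]; first by move=> n m [].
    case: n Hn => [n /(_ n) //|k _]; rewrite /a (qpoch_inf_eq0 (n := k)) ?mulr0 //.
    by rewrite -exprM exprnP -expfzDr // NegzE -[RHS](expr0z p); congr (_ ^ _); lia.
  apply: has_sum_ext (has_sumZ _ (euler x p21)) => n.
  rewrite /a expr_bin2 // (_ : p ^ (2 * n%:Z + 2) = p ^+ 2 * (p ^+ 2) ^+ n); last first.
    by rewrite -exprM -exprD exprnP; congr (_ ^ _); lia.
  rewrite (qpoch_infD _ n p21) -[(-1) ^ n%:Z]exprnP -[x ^ n%:Z]exprnP.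
  by field; rewrite qpochqq_neq0.
have := has_sum_unique H2 H3 => E.
suff -> : qpoch_inf x (p ^+ 2) * qpoch_inf (p ^+ 2 / x) (p ^+ 2) * qpoch_inf (p ^+ 2) (p ^+ 2)
  = theta by [].
by rewrite mulrAC [X in X * _]mulrC -E mulrAC -mulrA sE mulr1.
Qed.

Lemma Ja_theta a M q : q != 0 -> `|q| < 1 -> (0 < a < 2 * M)%N ->
  has_sum (fun n : int => (-1) ^ n * q ^ (M%:Z * n * n + (a%:Z - M%:Z) * n)) (Ja a (2 * M) q).
Proof.
move=> q0 q1 /andP[a0 aM]; have M0 : (0 < M)%N by lia.
have p1 : `|q ^+ M| < 1 by case: M M0 {aM} => // M _; exact: norm_pow_lt1.
have pE : (q ^+ M) ^+ 2 / q ^+ a = q ^+ (2 * M - a).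
  by rewrite -exprM mulnC expfB.
have aM1 : `|(q ^+ M) ^+ 2 / q ^+ a| < 1.
  by rewrite pE; case: (2 * M - a)%N (ltac:(lia) : (0 < 2 * M - a)%N) => // k _; exact: norm_pow_lt1.
have := jacobi_triple (expf_neq0 M q0) p1 (expf_neq0 a q0) aM1.
rewrite pE -exprM [(M * 2)%N]mulnC; apply: has_sum_ext => n.
by rewrite -mulrA !exprnP !exprz_exp -expfzDr //; congr (_ * _ ^ _); ring.
Qed.

Lemma Ja_theta_opp a M q : q != 0 -> `|q| < 1 -> (0 < a < 2 * M)%N ->
  has_sum (fun n : int => (-1) ^ n * q ^ (M%:Z * n * n + (M%:Z - a%:Z) * n)) (Ja a (2 * M) q).
Proof.
move=> q0 q1 aM; have := has_sum_bij (@opprK int) (@opprK int) (Ja_theta q0 q1 aM).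
apply: has_sum_ext => n; rewrite -exprz_inv invrN1; congr (_ * _ ^ _); ring.
Qed.

End TripleProduct.

(** * Bosonic formulas for Schur's recurrence *)

Section SchurPolynomials.
Context {R : realType} (q : R[i]).
Hypotheses (q0 : q != 0) (q1 : `|q| < 1).
Local Notation C := R[i].
Local Notation Q := (q ^+ 4).

(* The argument is doubled, and odd arguments give 0: in Schur's formula
   sum_l (-1)^l Q^(l(5l+1)/2) [N; floor((N-5l)/2)] the two parities of N - 5l then
   become two separate terms and no case analysis is needed. *)
Definition inv_qpoch_half (z : int) : C :=
  if z is Posz n then if odd n then 0 else (qpoch Q Q n./2)^-1 else 0.
Local Notation ip := inv_qpoch_half.

(* The Gaussian binomial [N; z/2] in base Q. *)
Definition qbin_half (N : nat) (z : int) : C :=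
  qpoch Q Q N * ip z * ip (2 * N%:Z - z).
Local Notation bb := qbin_half.

Let Q1 : `|Q| < 1. Proof. exact: norm_pow_lt1. Qed.

(** This is 1/(Q;Q)_(n-1) = (1 - Q^n)/(Q;Q)_n at z = 2n. At z = 0 the factor vanishes, which agrees
    with the value 0 at negative arguments; the Pascal rules therefore hold for all integers without
    side conditions. *)
Lemma inv_qpoch_half_sub2 z : ip (z - 2) = (1 - q ^ (2 * z)) * ip z.
Proof.
case: z => [[|[|n]]|n].
- by rewrite sub0r mulr0 expr0z subrr mul0r.
- by rewrite mulr0.
- rewrite (_ : n.+2%:Z - 2 = n%:Z); last by lia.
  rewrite /ip /= negbK; case: ifP => [|on]; first by rewrite mulr0.
  rewrite qpochSr (_ : q ^ (2 * n.+2%:Z) = Q * Q ^+ n./2).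
    have A := qpochqq_neq0 n./2 Q1; have B : 1 - Q * Q ^+ n./2 != 0.
      by rewrite -exprS one_sub_neq0 // norm_pow_lt1.
    by field; rewrite A B.
  rewrite -exprS -exprM exprnP; congr (_ ^ _).
  by have := odd_double_half n; rewrite on; lia.
- by rewrite (_ : Negz n - 2 = Negz n.+2) ?mulr0 //; lia.
Qed.

Lemma qbin_halfSr N z : bb N.+1 z = bb N z + q ^ (2 * (2 * N%:Z + 2 - z)) * bb N (z - 2).
Proof.
rewrite /bb qpochSr inv_qpoch_half_sub2; set w := 2 * N%:Z + 2 - z.
rewrite (_ : 2 * N.+1%:Z - z = w); last by rewrite /w; lia.
rewrite (_ : 2 * N%:Z - z = w - 2); last by rewrite /w; lia.
rewrite (_ : 2 * N%:Z - (z - 2) = w); last by rewrite /w; lia.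
(* After removing common factors the rule reads 1 - q^(2z) q^(2w) = (1 - q^(2w)) + q^(2w) (1 -
   q^(2z)). *)
rewrite inv_qpoch_half_sub2 (_ : Q * Q ^+ N = q ^ (2 * z) * q ^ (2 * w)); first by ring.
by rewrite -exprS -exprM exprnP -expfzDr //; congr (_ ^ _); rewrite /w; lia.
Qed.

Lemma qbin_halfSl N z : bb N.+1 z = bb N (z - 2) + q ^ (2 * z) * bb N z.
Proof.
rewrite /bb qpochSr inv_qpoch_half_sub2; set w := 2 * N%:Z + 2 - z.
rewrite (_ : 2 * N.+1%:Z - z = w); last by rewrite /w; lia.
rewrite (_ : 2 * N%:Z - z = w - 2); last by rewrite /w; lia.
rewrite (_ : 2 * N%:Z - (z - 2) = w); last by rewrite /w; lia.
rewrite inv_qpoch_half_sub2 (_ : Q * Q ^+ N = q ^ (2 * z) * q ^ (2 * w)); first by ring.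
by rewrite -exprS -exprM exprnP -expfzDr //; congr (_ ^ _); rewrite /w; lia.
Qed.

Lemma inv_qpoch_half_bounded : exists2 K : C, 0 < K & forall z, `|ip z| <= K.
Proof.
have [K K0 HK] := qpochqq_inv_bounded Q1; exists K => // -[n|n] /=.
  by case: ifP => _ //; rewrite normr0 ltW.
by rewrite normr0 ltW.
Qed.

Lemma qbin_half_bounded N : exists2 K : C, 0 < K & forall z, `|bb N z| <= K.
Proof.
have [K K0 HK] := inv_qpoch_half_bounded; exists ((`|qpoch Q Q N| + 1) * K * K) => [|z].
  by rewrite !mulr_gt0 // ltr_wpDl.
rewrite /bb !normrM; apply: ler_pM => //.
by apply: ler_pM => //; rewrite lerDl.
Qed.

Lemma abs_summable_quad (A : nat) (b c : int) (e : int -> int) (g : int -> C) K :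
  (0 < A)%N -> (forall l, e l = A%:Z * l * l + b * l + c) -> (forall l, `|g l| <= K) ->
  abs_summable (fun l => (-1) ^ l * q ^ e l * g l).
Proof.
move=> A0 eE gK; have qA : `|q ^+ A| < 1 by case: A A0 {eE} => // A _; exact: norm_pow_lt1.
apply: (abs_summable_le (k := K * `|q ^ c|) _ (abs_summable_gauss (q ^ b) qA)) => l.
rewrite (_ : q ^ e l = q ^ c * ((q ^+ A) ^ (l * l) * (q ^ b) ^ l)); last first.
  by rewrite exprnP !exprz_exp -!expfzDr // eE; congr (_ ^ _); ring.
rewrite !normrM (norm_exprz (-1)) normrN1 exp1rz mul1r mulrC -!mulrA.
by apply: ler_wpM2r => //; rewrite !mulr_ge0.
Qed.

Fixpoint schur (e0 e1 : C) (n : nat) : C :=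
  if n is m.+1 then
    if m is k.+1 then schur e0 e1 m + Q ^+ k * schur e0 e1 k else e1
  else e0.

Variable a : bool.
Local Notation X l := (2 * l * (5 * l + 1 + 2 * (a : nat)%:Z)).
Local Notation Y N l := (N%:Z - (a : nat)%:Z - 5 * l).
Local Notation E := (schur a%:R (~~ a)%:R).

(* Summed over l, the four representations give E_(N+1), E_N, (1 - Q^N) E_(N-1) and
   Q^N E_N for [E = schur]. *)
Definition schur_rep1 (N : nat) (l : int) : C :=
  (-1) ^ l * q ^ X l * (bb N (Y N l) + bb N (Y N l - 1)).
Definition schur_rep2 (N : nat) (l : int) : C :=
  (-1) ^ l * q ^ X l * (bb N (Y N l + 1) + bb N (Y N l - 2)).
Definition schur_rep3 (N : nat) (l : int) : C :=
  (-1) ^ l * q ^ X l * (bb N (Y N l + 2) + bb N (Y N l - 3)).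
Definition schur_rep4 (N : nat) (l : int) : C :=
  (-1) ^ l * q ^ X l * (q ^ (2 * (Y N l + 1)) * bb N (Y N l + 1)
     + q ^ (2 * (2 * N%:Z + 2 - Y N l)) * bb N (Y N l - 2)).

Lemma qbin_half0 z : bb 0 z = (z == 0)%:R.
Proof.
rewrite /bb qpoch0 mul1r mulr0 sub0r; case: z => [[|n]|n].
- by rewrite /ip /= qpoch0 invr1 mul1r.
- by rewrite [ip (- _)](_ : _ = 0) ?mulr0.
- by rewrite mul0r.
Qed.

(** The two binomials are expanded by opposite Pascal rules: the unweighted halves rebuild
    [schur_rep1], and [schur_rep4] is by design what remains. Summed over l, this is the recurrence
    of E. *)
Lemma schur_rep1_step N l : schur_rep1 N.+1 l = schur_rep1 N l + schur_rep4 N l.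
Proof.
rewrite /schur_rep1 /schur_rep4 (_ : Y N.+1 l = Y N l + 1); last by lia.
rewrite addrK (qbin_halfSl N (_ + 1)) (qbin_halfSr N (Y N l)).
rewrite (_ : Y N l + 1 - 2 = Y N l - 1); last by lia.
by ring.
Qed.

(* The part of each Pascal expansion that telescopes in l. *)
Let c (d : int) N l : C := (-1) ^ l * q ^ (X l + 2 * (Y N l + d)) * bb N (Y N l + d).

Let cS d N l : c d N (l + 1) =
  - ((-1) ^ l * q ^ X l * q ^ (2 * (2 * N%:Z + 1 + d - Y N l)) * bb N (Y N l - 5 + d)).
Proof.
rewrite /c [(-1) ^ (l + 1)]expfzDr ?oppr_eq0 ?oner_eq0 // expr1z mulrN1 !mulNr; congr (- (_ * _)).
  by rewrite -(mulrA ((-1) ^ l)); congr (_ * _); rewrite -expfzDr //; congr (_ ^ _); ring.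
by congr (bb _ _); ring.
Qed.

(** With the Pascal rules exchanged, the two weights on each of the inner binomials multiply to
    Q^(N+1); the outer two, at y + 2 and y - 3, are values of the same function at l and l + 1, with
    opposite signs. *)
Lemma schur_rep4_step N l :
  schur_rep4 N.+1 l = Q ^+ N.+1 * schur_rep1 N l + (c 2 N l - c 2 N (l + 1)).
Proof.
rewrite cS /c /schur_rep1 /schur_rep4 (_ : Y N.+1 l = Y N l + 1); last by lia.
set y := Y N l; rewrite (expfzDr (X l)) //.
rewrite (_ : y + 1 + 1 = y + 2); last by lia.
rewrite (_ : y + 1 - 2 = y - 1); last by lia.
rewrite (_ : y - 5 + 2 = y - 3); last by lia.
rewrite (qbin_halfSr N (y + 2)) (qbin_halfSl N (y - 1)).
rewrite (_ : y + 2 - 2 = y); last by lia.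
rewrite (_ : y - 1 - 2 = y - 3); last by lia.
have -> : Q ^+ N.+1 = q ^ (2 * (y + 2)) * q ^ (2 * (2 * N%:Z + 2 - (y + 2))).
  by rewrite -exprM exprnP -expfzDr //; congr (_ ^ _); lia.
have -> : q ^ (2 * (2 * N.+1%:Z + 2 - (y + 1))) = q ^ (2 * (2 * N%:Z + 1 + 2 - y)).
  by congr (_ ^ _); lia.
have H : q ^ (2 * (2 * N%:Z + 1 + 2 - y)) * q ^ (2 * (y - 1)) =
    q ^ (2 * (y + 2)) * q ^ (2 * (2 * N%:Z + 2 - (y + 2))).
  by rewrite -!expfzDr //; congr (_ ^ _); lia.
rewrite [q ^ (2 * (2 * N%:Z + 1 + 2 - y)) * (_ + _)]mulrDr.
by rewrite [q ^ (2 * (2 * N%:Z + 1 + 2 - y)) * (q ^ _ * _)]mulrA H; ring.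
Qed.

Lemma schur_rep2_step N l :
  schur_rep2 N.+1 l = schur_rep1 N l + (c 2 N l - c 2 N (l + 1)).
Proof.
rewrite cS /c /schur_rep1 /schur_rep2 (_ : Y N.+1 l = Y N l + 1); last by lia.
set y := Y N l; rewrite (expfzDr (X l)) //.
rewrite (_ : y + 1 + 1 = y + 2); last by lia.
rewrite (_ : y + 1 - 2 = y - 1); last by lia.
rewrite (_ : y - 5 + 2 = y - 3); last by lia.
rewrite (qbin_halfSl N (y + 2)) (qbin_halfSr N (y - 1)).
rewrite (_ : y + 2 - 2 = y); last by lia.
rewrite (_ : y - 1 - 2 = y - 3); last by lia.
have -> : q ^ (2 * (2 * N%:Z + 2 - (y - 1))) = q ^ (2 * (2 * N%:Z + 1 + 2 - y)).
  by congr (_ ^ _); lia.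
by ring.
Qed.

(** Here the telescoping terms are completed rather than read off: the binomials at y + 1 and y - 2
    come with [schur_rep4], and the second telescoping difference removes its surplus. *)
Lemma schur_rep3_step N l :
  schur_rep3 N.+1 l = schur_rep2 N l - Q * schur_rep4 N l
   + (c 3 N l - c 3 N (l + 1))
   + Q * (c 1 N l - c 1 N (l + 1)).
Proof.
rewrite !cS /c /schur_rep2 /schur_rep3 /schur_rep4 (_ : Y N.+1 l = Y N l + 1); last by lia.
set y := Y N l; rewrite !(expfzDr (X l)) //.
rewrite (_ : y + 1 + 2 = y + 3); last by lia.
rewrite (_ : y + 1 - 3 = y - 2); last by lia.
rewrite (_ : y - 5 + 3 = y - 2); last by lia.
rewrite (_ : y - 5 + 1 = y - 4); last by lia.
rewrite (qbin_halfSl N (y + 3)) (qbin_halfSr N (y - 2)).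
rewrite (_ : y + 3 - 2 = y + 1); last by lia.
rewrite (_ : y - 2 - 2 = y - 4); last by lia.
have -> : q ^ (2 * (y + 3)) = Q * q ^ (2 * (y + 1)).
  by rewrite exprnP -expfzDr //; congr (_ ^ _); lia.
have -> : q ^ (2 * (2 * N%:Z + 2 - (y - 2))) = Q * q ^ (2 * (2 * N%:Z + 2 - y)).
  by rewrite exprnP -expfzDr //; congr (_ ^ _); lia.
have -> : q ^ (2 * (2 * N%:Z + 1 + 3 - y)) = Q * q ^ (2 * (2 * N%:Z + 2 - y)).
  by rewrite exprnP -expfzDr //; congr (_ ^ _); lia.
have -> : q ^ (2 * (2 * N%:Z + 1 + 1 - y)) = q ^ (2 * (2 * N%:Z + 2 - y)).
  by congr (_ ^ _); lia.
by ring.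
Qed.

Let abs_c d N : abs_summable (c d N).
Proof.
have [K _ HK] := qbin_half_bounded N.
apply: (@abs_summable_quad 10 (4 * a%:Z - 8) (2 * (N%:Z - a%:Z + d)) _ _ K) => // l; ring.
Qed.

(** Proved jointly: the step for [schur_rep1] uses the sum of [schur_rep4], and conversely. *)
Lemma schur_rep14_sum N :
  has_sum (schur_rep1 N) (E N.+1) /\ has_sum (schur_rep4 N) (Q ^+ N * E N).
Proof.
elim: N => [|N [IH1 IH4]].
  split.
    rewrite (_ : E 1 = schur_rep1 0 0); last first.
      by rewrite /schur_rep1 !qbin_half0 !mulr0 !mul0r !expr0z !mul1r; case: a; rewrite ?addr0.
    apply: has_sum_single => l l0; rewrite /schur_rep1 !qbin_half0.
    have -> : Y 0%N l == 0 = false by apply/eqP; case: (a) => /=; move/eqP: l0; lia.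
    have -> : Y 0%N l - 1 == 0 = false by apply/eqP; case: (a) => /=; move/eqP: l0; lia.
    by rewrite addr0 mulr0.
  rewrite expr0 mul1r (_ : E 0 = schur_rep4 0 0); last first.
    by rewrite /schur_rep4 !qbin_half0 mulr0 mul0r !expr0z !mul1r; case: a; rewrite /= ?mulr0 ?addr0 ?mulr1.
  apply: has_sum_single => l l0; rewrite /schur_rep4 !qbin_half0.
  have -> : Y 0%N l + 1 == 0 = false by apply/eqP; case: (a) => /=; move/eqP: l0; lia.
  have -> : Y 0%N l - 2 == 0 = false by apply/eqP; case: (a) => /=; move/eqP: l0; lia.
  by rewrite !mulr0 addr0 mulr0.
split; first by apply: has_sum_ext (has_sumD IH1 IH4) => l; rewrite schur_rep1_step.
rewrite -[_ * _]addr0.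
apply: has_sum_ext (has_sumD (has_sumZ (Q ^+ N.+1) IH1) (has_sum_telescope (abs_c 2 N))) => l.
by rewrite schur_rep4_step.
Qed.

Lemma schur_rep2_sum N : has_sum (schur_rep2 N) (E N).
Proof.
case: N => [|N].
  rewrite (_ : E 0 = schur_rep2 0 0); last first.
    by rewrite /schur_rep2 !qbin_half0 !mulr0 !mul0r !expr0z !mul1r; case: a; rewrite /= ?addr0.
  apply: has_sum_single => l l0; rewrite /schur_rep2 !qbin_half0.
  have -> : Y 0%N l + 1 == 0 = false by apply/eqP; case: (a) => /=; move/eqP: l0; lia.
  have -> : Y 0%N l - 2 == 0 = false by apply/eqP; case: (a) => /=; move/eqP: l0; lia.
  by rewrite addr0 mulr0.
rewrite -[E _]addr0.
apply: has_sum_ext (has_sumD (schur_rep14_sum N).1 (has_sum_telescope (abs_c 2 N))) => l.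
by rewrite schur_rep2_step.
Qed.

Lemma schur_rep3_sum N : has_sum (schur_rep3 N.+1) ((1 - Q ^+ N.+1) * E N).
Proof.
rewrite (_ : _ * _ = E N - Q * (Q ^+ N * E N) + 0 + Q * 0); last by rewrite exprS; ring.
have T3 := has_sum_telescope (abs_c 3 N); have T1 := has_sum_telescope (abs_c 1 N).
have H := has_sumB (schur_rep2_sum N) (has_sumZ Q (schur_rep14_sum N).2).
apply: has_sum_ext (has_sumD (has_sumD H T3) (has_sumZ Q T1)) => l.
by rewrite schur_rep3_step.
Qed.

(** At N = 0 the value (1 - Q^N) E_(N-1) would involve E_(-1); the sum is 0 because every term
    is. *)
Lemma schur_rep3_sum0 : has_sum (schur_rep3 0) 0.
Proof.
apply: has_sum_ext has_sum0 => l; rewrite /schur_rep3 !qbin_half0.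
have -> : Y 0%N l + 2 == 0 = false by apply/eqP; case: (a) => /=; lia.
have -> : Y 0%N l - 3 == 0 = false by apply/eqP; case: (a) => /=; lia.
by rewrite addr0 mulr0.
Qed.

End SchurPolynomials.

(** * A conjugate Bailey pair *)

Section BaileyPair.
Context {R : realType} (q : R[i]).
Hypotheses (q0 : q != 0) (q1 : `|q| < 1).
Local Notation C := R[i].
Local Notation Q := (q ^+ 4).
Local Notation ip := (inv_qpoch_half q).
Local Notation bb := (qbin_half q).

Let Q1 : `|Q| < 1. Proof. exact: norm_pow_lt1. Qed.

Lemma norm_qpoch_le a b n : `|a| <= 1 -> `|b| <= 1 -> `|qpoch a b n : C| <= 2 ^+ n.
Proof.
move=> a1 b1; elim: n => [|n IHn]; first by rewrite qpoch0 normr1.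
rewrite qpochSr normrM exprSr; apply: ler_pM => //.
rewrite (_ : 2 = 1 + 1) //; apply: le_trans (ler_normB _ _) _; rewrite normr1 lerD2l.
by rewrite normrM mulr_ile1 // normrX exprn_ile1.
Qed.

(** The case rho_1 = q^2, rho_2 tending to infinity, of the classical sequence (rho_1;Q)_m
    (rho_2;Q)_m (Q / (rho_1 rho_2))^m. *)
Definition bailey_weight (m : nat) : C :=
  (-1) ^+ m * q ^+ (2 * m ^ 2) * qpoch (q ^+ 2) Q m.
Local Notation w := bailey_weight.

Lemma abs_summable_bailey_weight : abs_summable w.
Proof.
apply: (abs_summable_le (k := 1) _ (abs_summable_bin (2 * q ^+ 2) Q1)) => m.
rewrite mul1r /w (_ : (2 * m ^ 2 = 4 * 'C(m, 2) + 2 * m)%N); last first.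
  by elim: m => // m IHm; rewrite binS bin1; nia.
rewrite exprD [q ^+ (4 * _)]exprM [q ^+ (2 * m)]exprM [(2 * _) ^+ m]exprMn.
rewrite normrM [leRHS](_ : _ = `|(-1) ^+ m * (Q ^+ 'C(m, 2) * (q ^+ 2) ^+ m)| * 2 ^+ m).
  apply: ler_wpM2l => //; apply: norm_qpoch_le; last exact: ltW.
  by rewrite ltW // norm_pow_lt1.
rewrite !normrM (normrX m (-1)) normrN1 expr1n mul1r.
by rewrite (ger0_norm (x := 2 ^+ m)) ?exprn_ge0 // mulrCA mulrC.
Qed.

Lemma abs_weight_inv_qpoch s t : abs_summable (fun m : nat => w m * (ip (2 * m%:Z - s) * ip (2 * m%:Z + t))).
Proof.
have [K K0 HK] := inv_qpoch_half_bounded q1.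
apply: (abs_summable_le (k := K * K) _ abs_summable_bailey_weight) => m.
by rewrite normrM mulrC ler_wpM2r // normrM ler_pM.
Qed.

(* The sequence [g] is the certificate of the recurrence in [s]. *)
Lemma weight_inv_qpoch_step (s : nat) B :
  has_sum (fun m : nat => w m * (ip (2 * m%:Z - s%:Z) * ip (2 * m%:Z + s%:Z))) B ->
  has_sum (fun m : nat => w m * (ip (2 * m%:Z - s.+2%:Z) * ip (2 * m%:Z + s.+2%:Z)))
    (- q ^+ (2 * s + 2) * B).
Proof.
move=> HB; set y := q ^+ (2 * s + 2).
pose g (m : nat) : C := - (1 + y) * (w m * (ip (2 * m%:Z - s.+2%:Z) * ip (2 * m%:Z + s%:Z))).
have ag : abs_summable g.
  apply: (abs_summable_le (k := `|1 + y|) _ (abs_weight_inv_qpoch s.+2%:Z s%:Z)) => m.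
  by rewrite /g normrM normrN.
have g0 : g 0%N = 0.
  by rewrite /g mulr0 sub0r mul0r !mulr0.
have := has_sumD (has_sum_telescope_nat ag g0) (has_sumZ (- y) HB).
rewrite add0r; apply: has_sum_ext => m.
rewrite /g; set u := ip (2 * m%:Z - s%:Z); set v := ip (2 * m%:Z + s.+2%:Z).
have E1 : ip (2 * m%:Z - s.+2%:Z) = (1 - q ^ (2 * (2 * m%:Z - s%:Z))) * u.
  by rewrite -inv_qpoch_half_sub2 //; congr (ip _); lia.
have E2 : ip (2 * m%:Z + s%:Z) = (1 - q ^ (2 * (2 * m%:Z + s.+2%:Z))) * v.
  by rewrite -inv_qpoch_half_sub2 //; congr (ip _); lia.
rewrite (_ : ip (2 * m.+1%:Z - s.+2%:Z) = u); last by congr (ip _); lia.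
rewrite (_ : ip (2 * m.+1%:Z + s%:Z) = v); last by congr (ip _); lia.
rewrite E1 E2.
have wS : w m.+1 = - q ^+ (4 * m + 2) * (1 - q ^+ (4 * m + 2)) * w m.
  rewrite /w qpochSr exprS (_ : (2 * m.+1 ^ 2 = 2 * m ^ 2 + (4 * m + 2))%N); last by nia.
  rewrite exprD (_ : q ^+ 2 * Q ^+ m = q ^+ (4 * m + 2)); first by ring.
  by rewrite -exprM -exprD addnC.
have y0 : y != 0 by rewrite expf_neq0.
set x := q ^+ (4 * m + 2) in wS.
have E3 : q ^ (2 * (2 * m%:Z - s%:Z)) = x / y.
  by rewrite /x /y !exprnP invr_expz -expfzDr //; congr (_ ^ _); lia.
have E4 : q ^ (2 * (2 * m%:Z + s.+2%:Z)) = x * y.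
  by rewrite /x /y !exprnP -expfzDr //; congr (_ ^ _); lia.
by rewrite wS E3 E4; field.
Qed.

(** The conjugate sequence up to its constant, with the index doubled; it is 0 at odd s because
    [inv_qpoch_half] is. *)
Definition theta_coef (s : int) : C :=
  if odd `|s|%N then 0 else (-1) ^+ `|s|%N./2 * q ^+ (2 * `|s|%N./2 ^ 2).

Lemma theta_coef_even (r : int) : theta_coef (2 * r) = (-1) ^ r * q ^ (2 * r * r).
Proof.
rewrite /theta_coef (_ : `|(2 * r)%R|%N = `|r|%N.*2); last by lia.
rewrite odd_double doubleK !exprnP.
rewrite (_ : 2 * r * r = (2 * `|r|%N ^ 2)%N); last by nia.
congr (_ * _); case: r => // n; rewrite NegzE -exprz_inv invrN1 abszN absz_nat //.
Qed.

Lemma cvg_qpoch_inv_double :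
  ((fun n : nat => (qpoch Q Q (2 * n))^-1 : R[i]^o) @ \oo --> ((qpoch_inf Q Q)^-1 : R[i]^o))%classic.
Proof.
apply: cvgV; first exact: qpoch_inf_qq_neq0.
apply/cvgrPdist_le => e e0.
have /cvgrPdist_le/(_ _ e0)[N _ HN] := cvg_qpoch (a := Q) Q1.
by exists N => // n /= Nn; apply: HN => /=; lia.
Qed.

(** The summand at s = 2r and m = r + n, divided by (-1)^r q^(2r^2) (q^2;Q)_r; without that factor
    it has a nonzero limit at n = 0 as r grows. *)
Definition bailey_tail (r n : nat) : C :=
  (-1) ^+ n * q ^+ (2 * n ^ 2 + 4 * r * n) * qpoch (q ^+ 2 * Q ^+ r) Q n
    / (qpoch Q Q n * qpoch Q Q (n + 2 * r)).

Lemma bailey_tail_le : exists2 K : C, 0 <= K & forall r n,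
  `|bailey_tail r n| <= K * (`|Q ^+ (r * n)| * `|Q ^+ 'C(n, 2) * (2 * q ^+ 2) ^+ n|).
Proof.
have [K K0 HK] := qpochqq_inv_bounded Q1; exists (K * K) => [|r n]; first by rewrite mulr_ge0 ?ltW.
rewrite /bailey_tail invfM normrM mulrC; apply: ler_pM => //; first by rewrite normrM ler_pM.
rewrite (_ : q ^+ (2 * n ^ 2 + 4 * r * n) = Q ^+ 'C(n, 2) * (q ^+ 2) ^+ n * Q ^+ (r * n)); last first.
  rewrite -!exprM -!exprD; congr (_ ^+ _).
  by elim: n => [|n IHn]; rewrite ?muln0 // binS bin1; nia.
rewrite [(2 * _) ^+ n]exprMn.
rewrite normrM [leRHS](_ : _ = `|(-1) ^+ n * (Q ^+ 'C(n, 2) * (q ^+ 2) ^+ n * Q ^+ (r * n))| * 2 ^+ n).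
  apply: ler_wpM2l => //; apply: norm_qpoch_le; last exact: ltW.
  rewrite -exprM -exprD normrX exprn_ile1 // ltW //.
rewrite !normrM (normrX n (-1)) normrN1 expr1n mul1r (ger0_norm (x := 2 ^+ n)) ?exprn_ge0 //.
by ring.
Qed.

Lemma abs_bailey_tail r : abs_summable (bailey_tail r).
Proof.
have [K K0 HK] := bailey_tail_le.
apply: (abs_summable_le (k := K) _ (abs_summable_bin (2 * q ^+ 2) Q1)) => n.
apply: le_trans (HK r n) _; rewrite ler_wpM2l // ler_piMl //.
by rewrite normrX exprn_ile1 // ltW.
Qed.

(* Only the term n = 0 survives as r tends to infinity, which fixes the constant in the
   conjugate Bailey pair. *)
Lemma bailey_tail_cvg (T : nat -> C) : (forall r, has_sum (bailey_tail r) (T r)) ->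
  ((T : nat -> R[i]^o) @ \oo --> ((qpoch_inf Q Q)^-1 : R[i]^o))%classic.
Proof.
move=> TP; have [K K0 HK] := bailey_tail_le.
have [B HB] := abs_summable_bin (2 * q ^+ 2) Q1.
have B0 : 0 <= B by apply: le_trans (HB fset0); rewrite sumr_ge0.
have H : (((fun r => T r - (qpoch Q Q (2 * r))^-1) : nat -> R[i]^o) @ \oo --> (0 : R[i]^o))%classic.
  apply: (cvg_dist0 _ (cvg_pow0 (K * B) Q1)) => r; rewrite subr0.
  have E0 : bailey_tail r 0 = (qpoch Q Q (2 * r))^-1.
    by rewrite /bailey_tail muln0 !qpoch0 add0n !expr0 !mul1r.
  have H1 : has_sum (fun n => (n == 0%N)%:R * bailey_tail r n) (qpoch Q Q (2 * r))^-1.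
    have := @has_sum_single _ _ (fun n => (n == 0%N)%:R * bailey_tail r n) 0%N.
    by rewrite eqxx mul1r E0; apply => n /negPf ->; rewrite mul0r.
  apply: norm_sum_le (has_sumB (TP r) H1) _ => F.
  (* For n >= 1 the factor Q^(rn) in the bound supplies Q^r, so everything but the term n = 0 is of
     size |Q^r|. *)
  apply: le_trans (_ : K * `|Q ^+ r| * \sum_(n <- F) `|Q ^+ 'C(n, 2) * (2 * q ^+ 2) ^+ n| <= _).
    rewrite mulr_sumr; apply: ler_sum => n _.
    case: n => [|n]; first by rewrite mul1r subrr normr0 !mulr_ge0.
    rewrite mul0r subr0; apply: le_trans (HK r n.+1) _; rewrite -mulrA ler_wpM2l //.
    by rewrite ler_wpM2r // mulnS exprD normrM ler_piMr // normrX exprn_ile1 // ltW.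
  rewrite normrM (ger0_norm (mulr_ge0 K0 B0)) mulrAC ler_wpM2r // ler_wpM2l //.
apply/cvgrPdist_le => e e0; have e20 : 0 < e / 2 by rewrite divr_gt0.
have /cvgrPdist_le/(_ _ e20) := H; have /cvgrPdist_le/(_ _ e20) := cvg_qpoch_inv_double.
move=> [N1 _ H1] [N2 _ H2]; exists (maxn N1 N2) => // r /=; rewrite geq_max => /andP[r1 r2].
have /= := H2 r r2; have /= := H1 r r1; rewrite sub0r normrN => A1 A2.
rewrite (_ : _ - T r = (qpoch_inf Q Q)^-1 - (qpoch Q Q (2 * r))^-1 - (T r - (qpoch Q Q (2 * r))^-1)).
  by rewrite (splitr e); apply: le_trans (ler_normB _ _) _; exact: lerD.
by rewrite opprB addrA subrK.
Qed.

Lemma weight_inv_qpoch_tail r : forall T, has_sum (bailey_tail r) T ->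
  has_sum (fun m : nat => w m * (ip (2 * m%:Z - (2 * r)%:Z) * ip (2 * m%:Z + (2 * r)%:Z)))
   ((-1) ^+ r * q ^+ (2 * r ^ 2) * qpoch (q ^+ 2) Q r * T).
Proof.
move=> T HT; apply/(has_sum_inj _ (@addnI r)) => [m Hm|].
  have mr : (m < r)%N by rewrite ltnNge; apply/negP => rm; apply: (Hm (m - r)%N); lia.
  rewrite (_ : 2 * m%:Z - (2 * r)%:Z = Negz (2 * (r - m)).-1); last by lia.
  by rewrite mul0r mulr0.
apply: has_sum_ext (has_sumZ _ HT) => n.
rewrite (_ : 2 * (r + n)%N%:Z - (2 * r)%:Z = n.*2%:Z); last by lia.
rewrite (_ : 2 * (r + n)%N%:Z + (2 * r)%:Z = (n + 2 * r).*2%:Z); last by lia.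
rewrite /inv_qpoch_half !odd_double !doubleK /w /bailey_tail (qpochD (q ^+ 2)).
rewrite (_ : (2 * (r + n) ^ 2 = 2 * r ^ 2 + (2 * n ^ 2 + 4 * r * n))%N); last by nia.
by rewrite invfM (exprD (-1)) (exprD q (2 * r ^ 2)); ring.
Qed.

Definition bailey_const : C := qpoch_inf (q ^+ 2) Q / qpoch_inf Q Q.

Lemma bailey_conjugate (s : int) :
  has_sum (fun m : nat => w m * (ip (2 * m%:Z - s) * ip (2 * m%:Z + s)))
    (bailey_const * theta_coef s).
Proof.
wlog s0 : s / 0 <= s => [IH|].
  case: (lerP 0 s) => [|/ltW sneg]; first exact: IH.
  have /IH : 0 <= - s by rewrite oppr_ge0.
  rewrite /theta_coef abszN; apply: has_sum_ext => m.
  by rewrite opprK [ip _ * _]mulrC.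
case: s s0 => // s _; case os : (odd s).
  rewrite /theta_coef absz_nat os mulr0; apply: has_sum_ext has_sum0 => m.
  rewrite [X in _ * (_ * X)](_ : _ = 0) ?mulr0 //.
  rewrite (_ : 2 * m%:Z + s%:Z = (m.*2 + s)%N%:Z); last by lia.
  by rewrite /inv_qpoch_half oddD odd_double os.
rewrite -(odd_double_half s) os add0n; move: s./2 => r {s os}.
rewrite -mul2n (_ : theta_coef _ = (-1) ^+ r * q ^+ (2 * r ^ 2)); last first.
  rewrite PoszM theta_coef_even !exprnP; congr (_ * _ ^ _); lia.
have /choice[T HT] : forall r, exists t, has_sum (bailey_tail r) t.
  by move=> k; apply: abs_has_sum; exact: abs_bailey_tail.
(* The sum divided by its expected dependence on r. The recurrence makes G constant, and its limit
   as r grows is [bailey_const]. *)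
pose G r := qpoch (q ^+ 2) Q r * T r.
have GP k : has_sum (fun m : nat => w m * (ip (2 * m%:Z - (2 * k)%:Z) * ip (2 * m%:Z + (2 * k)%:Z)))
   ((-1) ^+ k * q ^+ (2 * k ^ 2) * G k).
  by rewrite mulrA; exact: weight_inv_qpoch_tail.
have GS k : G k.+1 = G k.
  have := weight_inv_qpoch_step (GP k); rewrite (_ : (2 * k).+2 = (2 * k.+1)%N); last by lia.
  move=> /(has_sum_unique (GP k.+1)).
  rewrite exprS (_ : (2 * k.+1 ^ 2 = 2 * k ^ 2 + (2 * (2 * k) + 2))%N); last by nia.
  rewrite (exprD q (2 * k ^ 2)).
  move=> E; have c0 : (-1) ^+ k * (q ^+ (2 * k ^ 2) * q ^+ (2 * (2 * k) + 2)) != 0 :> C.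
    by rewrite !mulf_neq0 ?expf_neq0 ?oppr_eq0 ?oner_eq0.
  by apply: (mulfI c0); apply: oppr_inj; etransitivity; [|etransitivity; [exact: E|]]; ring.
have GE k : G k = bailey_const.
  have {}GS n : G n = G 0%N by elim: n => [//|n IHn]; rewrite GS.
  have G1 : ((G : nat -> R[i]^o) @ \oo --> (bailey_const : R[i]^o))%classic.
    by apply: (@cvgM _ _ _ _ (qpoch (q ^+ 2) Q) T); [exact: cvg_qpoch | exact: bailey_tail_cvg].
  have G2 : ((G : nat -> R[i]^o) @ \oo --> (G k : R[i]^o))%classic.
    rewrite (_ : G = fun=> G k); first exact: cvg_cst.
    by apply/funext => n; rewrite GS [RHS]GS.
  exact: (@cvg_unique R[i]^o _ _ _ _ _ G2 G1).
by have := GP r; rewrite GE [_ * bailey_const]mulrC.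
Qed.

(** Interchange of summation: the exponents in l are free of m, so the sum over m can be done first
    by [bailey_conjugate]. The quadratic form of e1 and e2 gives the absolute summability that the
    interchange needs. *)
Lemma bailey_sum (a : int) (e1 e2 : int -> int) (b1 c1 b2 c2 d1 d2 : int) (L : nat -> C) (V : C) :
  (forall l, e1 l = 10 * l * l + b1 * l + c1) ->
  (forall l, e2 l = 10 * l * l + b2 * l + c2) ->
  (forall m, has_sum (fun l => (-1) ^ l * q ^ e1 l * bb (2 * m) (2 * m%:Z - (a + 5 * l - d1))
     + (-1) ^ l * q ^ e2 l * bb (2 * m) (2 * m%:Z - (a + 5 * l - d2))) (L m)) ->
  has_sum (fun l => (-1) ^ l * q ^ e1 l * theta_coef (a + 5 * l - d1)
     + (-1) ^ l * q ^ e2 l * theta_coef (a + 5 * l - d2)) V ->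
  has_sum (fun m => w m / qpoch Q Q (2 * m) * L m) (bailey_const * V).
Proof.
move=> e1E e2E HL HV; have [K K0 HK] := inv_qpoch_half_bounded q1.
pose f (e : int -> int) (d : int) (x : nat * int) := (-1) ^ x.2 * q ^ e x.2 *
  (w x.1 * (ip (2 * x.1%:Z - (a + 5 * x.2 - d)) * ip (2 * x.1%:Z + (a + 5 * x.2 - d)))).
have af e b c d : (forall l, e l = 10 * l * l + b * l + c) -> abs_summable (f e d).
  move=> eE.
  have aq : abs_summable (fun l : int => (-1) ^ l * q ^ e l * 1).
    by apply: (@abs_summable_quad _ q q0 q1 10 b c e (fun=> 1) 1) => // l; rewrite normr1.
  apply: (abs_summable_le (k := K * K) _ (abs_summable_prod abs_summable_bailey_weight aq)) => -[m l] /=.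
  rewrite /f /= mulr1; set u := (-1) ^ l * _; set i1 := ip _; set i2 := ip _.
  rewrite (_ : u * (w m * (i1 * i2)) = i1 * i2 * (w m * u)); last by ring.
  by rewrite normrM ler_wpM2r // normrM; apply: ler_pM => //; exact: HK.
have [s1 H1] := abs_has_sum (af _ _ _ d1 e1E).
have [s2 H2] := abs_has_sum (af _ _ _ d2 e2E).
have H := has_sumD H1 H2.
have Hl e d l : has_sum (fun m => f e d (m, l))
    (bailey_const * ((-1) ^ l * q ^ e l * theta_coef (a + 5 * l - d))).
  have E : (-1) ^ l * q ^ e l * (bailey_const * theta_coef (a + 5 * l - d)) =
      bailey_const * ((-1) ^ l * q ^ e l * theta_coef (a + 5 * l - d)).
    by move: bailey_const => k; ring.
  by rewrite -E; apply: has_sum_ext (has_sumZ _ (bailey_conjugate _)) => m.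
have -> : bailey_const * V = s1 + s2.
  apply: has_sum_unique (has_sumZ bailey_const HV) _.
  have Hs : has_sum (fun x : int * nat => f e1 d1 (x.2, x.1) + f e2 d2 (x.2, x.1)) (s1 + s2).
    by apply: (has_sum_bij (h := fun x : int * nat => (x.2, x.1))
      (h' := fun x : nat * int => (x.2, x.1)) _ _ H) => -[? ?].
  apply: (has_sum_pair Hs) => l; rewrite mulrDr.
  by apply: has_sumD; exact: Hl.
apply: (has_sum_pair H) => m; apply: has_sum_ext (has_sumZ _ (HL m)) => l.
have Qm : qpoch Q Q (2 * m) != 0 by exact: qpochqq_neq0.
rewrite /f /qbin_half /= (_ : (2 * m)%N%:Z = 2 * m%:Z); last by lia.
have E s : 2 * (2 * m%:Z) - (2 * m%:Z - s) = 2 * m%:Z + s by lia.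
by rewrite !E /w; field.
Qed.

(** [theta_coef] kills the l for which a + 5l - d is odd, and the remaining ones are l = 2n + eps,
    where the argument is 2 (5n + r0). The two signs combine to (-1)^(eps + r0) (-1)^n. *)
Lemma theta_half (a d eps r0 c0 b : int) (e : int -> int) (J0 : C) :
  2 * r0 = 5 * eps + a - d ->
  (forall n : int, e (2 * n + eps) + 2 * (5 * n + r0) * (5 * n + r0) = 90 * n * n + b * n + c0) ->
  has_sum (fun n : int => (-1) ^ n * q ^ (90 * n * n + b * n)) J0 ->
  has_sum (fun l : int => (-1) ^ l * q ^ e l * theta_coef (a + 5 * l - d))
    ((-1) ^ (eps + r0) * q ^ c0 * J0).
Proof.
move=> r0E eE HJ.
apply/(has_sum_inj (h := fun n => 2 * n + eps)) => [n m|l Hl|]; first by lia.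
  rewrite /theta_coef ifT ?mulr0 //; apply: contraT => os.
  have [n nE] : exists n : int, l = 2 * n + eps.
    by exists ((l - eps) %/ 2)%Z; lia.
  by case: (Hl n).
apply: has_sum_ext (has_sumZ _ HJ) => n.
rewrite (_ : a + 5 * (2 * n + eps) - d = 2 * (5 * n + r0)); last by lia.
rewrite theta_coef_even.
have -> : (-1) ^ (2 * n + eps) * q ^ e (2 * n + eps) * ((-1) ^ (5 * n + r0) * q ^ (2 * (5 * n + r0) * (5 * n + r0)))
  = ((-1) ^ (2 * n + eps) * (-1) ^ (5 * n + r0)) * (q ^ e (2 * n + eps) * q ^ (2 * (5 * n + r0) * (5 * n + r0))).
  by ring.
rewrite -(expfzDr (e _)) // eE.
have -> : (-1) ^ (2 * n + eps) * (-1) ^ (5 * n + r0) = (-1) ^ (eps + r0) * (-1) ^ n :> C.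
  rewrite -!expfzDr ?oppr_eq0 ?oner_eq0 //.
  rewrite (_ : 2 * n + eps + (5 * n + r0) = eps + r0 + n + 2 * (3 * n)); last by ring.
  by rewrite expfzDr ?oppr_eq0 ?oner_eq0 // -exprz_exp -exprnP sqrrN expr1n exp1rz mulr1.
by rewrite (expfzDr _ c0) //; ring.
Qed.

End BaileyPair.

(** * Theta series of modulus 180 *)

Section ThetaEvaluations.
Context {R : realType} (q : R[i]).
Hypotheses (q0 : q != 0) (q1 : `|q| < 1).
Local Notation C := R[i].
Local Notation Q := (q ^+ 4).
Local Notation bb := (qbin_half q).
Local Notation w := (bailey_weight q).
Local Notation J a := (Ja a 180 q).
Local Notation K := (bailey_const q).

Lemma Ja180_theta (a : nat) (b : int) : (0 < a < 180)%N -> b = a%:Z - 90 \/ b = 90 - a%:Z ->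
  has_sum (fun n : int => (-1) ^ n * q ^ (90 * n * n + b * n)) (J a).
Proof.
by move=> a0 [->|->]; [exact: (@Ja_theta _ a 90 q)|exact: (@Ja_theta_opp _ a 90 q)].
Qed.

Local Notation X a l := (2 * l * (5 * l + 1 + 2 * (a : nat)%:Z)).
Local Notation theta a d e := (fun l : int =>
  (-1) ^ l * q ^ e l * theta_coef q ((a : nat)%:Z + 5 * l - d)).

Lemma bailey_rep (a : bool) (d1 d2 : int) (L : nat -> C) V1 V2 :
  (forall m, has_sum (fun l => (-1) ^ l * q ^ (X a l) *
     (bb (2 * m) ((2 * m)%N%:Z - (a : nat)%:Z - 5 * l + d1)
      + bb (2 * m) ((2 * m)%N%:Z - (a : nat)%:Z - 5 * l + d2))) (L m)) ->
  has_sum (theta a d1 (fun l => X a l)) V1 -> has_sum (theta a d2 (fun l => X a l)) V2 ->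
  has_sum (fun m => w m / qpoch Q Q (2 * m) * L m) (K * (V1 + V2)).
Proof.
move=> HL H1 H2.
have Xq l : X a l = 10 * l * l + (2 + 4 * (a : nat)%:Z) * l + 0 by ring.
apply: (bailey_sum q0 q1 Xq Xq _ (has_sumD H1 H2)) => m.
apply: has_sum_ext (HL m) => l; rewrite mulrDr.
by congr (_ * bb _ _ + _ * bb _ _); lia.
Qed.

(** [schur_rep4] at N = 2m sums to Q^(2m) E_(2m), and both of its weights contain Q^m. Dividing by
    Q^m leaves exponents independent of m, as [bailey_sum] requires. *)
Lemma bailey_rep4 (a : bool) V1 V2 :
  has_sum (theta a 1 (fun l => X a l + (2 - 2 * (a : nat)%:Z - 10 * l))) V1 ->
  has_sum (theta a (- 2) (fun l => X a l + (4 + 2 * (a : nat)%:Z + 10 * l))) V2 ->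
  has_sum (fun m => w m / qpoch Q Q (2 * m) * (Q ^+ m * schur q a%:R (~~ a)%:R (2 * m)))
    (K * (V1 + V2)).
Proof.
move=> H1 H2.
have X1 l : X a l + (2 - 2 * (a : nat)%:Z - 10 * l) =
   10 * l * l + (4 * (a : nat)%:Z - 8) * l + (2 - 2 * (a : nat)%:Z) by ring.
have X2 l : X a l + (4 + 2 * (a : nat)%:Z + 10 * l) =
   10 * l * l + (12 + 4 * (a : nat)%:Z) * l + (4 + 2 * (a : nat)%:Z) by ring.
apply: (bailey_sum q0 q1 X1 X2 _ (has_sumD H1 H2)) => m.
have Qm : Q ^+ m != 0 by rewrite !expf_neq0.
have := has_sumZ (Q ^+ m)^-1 (schur_rep14_sum q0 q1 a (2 * m)).2.
rewrite (_ : Q ^+ (2 * m) = Q ^+ m * Q ^+ m); last by rewrite mul2n -addnn exprD.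
rewrite -[Q ^+ m * _ * _]mulrA mulKf //.
apply: has_sum_ext => l; rewrite /schur_rep4 !(expfzDr (X a l)) //.
rewrite (_ : (2 * m)%N%:Z = 2 * m%:Z) //; set y := 2 * m%:Z - (a : nat)%:Z - 5 * l.
rewrite (_ : 2 * m%:Z - ((a : nat)%:Z + 5 * l - 1) = y + 1); last by rewrite /y; lia.
rewrite (_ : 2 * m%:Z - ((a : nat)%:Z + 5 * l - - 2) = y - 2); last by rewrite /y; lia.
have -> : q ^ (2 * (y + 1)) = Q ^+ m * q ^ (2 - 2 * (a : nat)%:Z - 10 * l).
  by rewrite -exprM exprnP -expfzDr //; congr (_ ^ _); rewrite /y; lia.
have -> : q ^ (2 * (2 * (2 * m%:Z) + 2 - y)) = Q ^+ m * q ^ (4 + 2 * (a : nat)%:Z + 10 * l).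
  by rewrite -exprM exprnP -expfzDr //; congr (_ ^ _); rewrite /y; lia.
by field.
Qed.

(** The parity of eps is forced by a and d; changing eps by 2 shifts n and changes b by 180, so
    exactly one choice puts b strictly between -90 and 90, where it is j - 90 or 90 - j. *)
Lemma theta_J (a : bool) (d eps r0 b : int) (e : int -> int) (k c j : nat) :
  2 * r0 = 5 * eps + (a : nat)%:Z - d ->
  (forall n : int, e (2 * n + eps) + 2 * (5 * n + r0) * (5 * n + r0) = 90 * n * n + b * n + c%:Z) ->
  (0 < j < 180)%N -> b = j%:Z - 90 \/ b = 90 - j%:Z -> `|(eps + r0)%R|%N = k ->
  has_sum (theta a d e) ((-1) ^+ k * q ^+ c * J j).
Proof.
move=> r0E eE j0 bE <-; have := theta_half q0 q1 r0E eE (Ja180_theta j0 bE).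
rewrite !exprnP (_ : (-1) ^ (eps + r0) = (-1) ^ `|(eps + r0)%R|%N :> C) //.
by case: (eps + r0) => // n; rewrite NegzE -exprz_inv invrN1 abszN absz_nat.
Qed.

Lemma schur_decomp (e : nat -> C) n : (forall n, e n.+2 = e n.+1 + Q ^+ n * e n) ->
  e n = e 1%N * schur q 0 1 n + e 0%N * schur q 1 0 n.
Proof.
move=> eS; elim/ltn_ind: n => -[|[|n]] IH; rewrite /= ?mulr0 ?mulr1 ?addr0 ?add0r //.
by rewrite eS (IH n.+1) // (IH n) //=; ring.
Qed.

Section Values.
Variable e : nat -> C.
Hypothesis eS : forall n, e n.+2 = e n.+1 + Q ^+ n * e n.

Lemma schur_rep1_sum_double (a : bool) m :
  has_sum (fun l => (-1) ^ l * q ^ (X a l) *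
     (bb (2 * m) ((2 * m)%N%:Z - (a : nat)%:Z - 5 * l + 0)
      + bb (2 * m) ((2 * m)%N%:Z - (a : nat)%:Z - 5 * l + (- 1))))
    (schur q a%:R (~~ a)%:R (2 * m).+1).
Proof.
by apply: has_sum_ext (schur_rep14_sum q0 q1 a (2 * m)).1 => l; rewrite addr0.
Qed.

Lemma schur_value1 : has_sum (fun m => w m / qpoch Q Q (2 * m) * e (2 * m).+1)
  (K * (e 1%N * (J 86 - q ^+ 16 * J 14) - q ^+ 2 * e 0%N * (J 58 + q ^+ 10 * J 22))).
Proof.
have T01 : has_sum (theta false 0 (fun l => X false l)) _ :=
  @theta_J false 0 0 0 4 (fun l => X false l) 0 0 86 erefl ltac:(move=> n /=; ring) isT ltac:(by [left|right]) erefl.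
have T02 : has_sum (theta false (- 1) (fun l => X false l)) _ :=
  @theta_J false (- 1) (- 1) (- 2) (- 76) (fun l => X false l) 3 16 14 erefl ltac:(move=> n /=; ring) isT ltac:(by [left|right]) erefl.
have S0 : has_sum _ _ := @bailey_rep false 0 (- 1) (fun m => schur q 0 1 (2 * m).+1) _ _ (fun m => schur_rep1_sum_double false m) T01 T02.
have T11 : has_sum (theta true 0 (fun l => X true l)) _ :=
  @theta_J true 0 (- 1) (- 2) (- 68) (fun l => X true l) 3 12 22 erefl ltac:(move=> n /=; ring) isT ltac:(by [left|right]) erefl.
have T12 : has_sum (theta true (- 1) (fun l => X true l)) _ :=
  @theta_J true (- 1) 0 1 32 (fun l => X true l) 1 2 58 erefl ltac:(move=> n /=; ring) isT ltac:(by [left|right]) erefl.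
have S1 : has_sum _ _ := @bailey_rep true 0 (- 1) (fun m => schur q 1 0 (2 * m).+1) _ _ (fun m => schur_rep1_sum_double true m) T11 T12.
apply: has_sum_eq (has_sumD (has_sumZ (e 1%N) S0) (has_sumZ (e 0%N) S1)) _ _ => [m|]; last by move: (@Ja R) (bailey_const q) => F k; ring.
by rewrite (schur_decomp (2 * m).+1 eS); ring.
Qed.

Lemma schur_value2 : has_sum (fun m => w m / qpoch Q Q (2 * m) * e (2 * m)%N)
  (K * (e 0%N * (J 78 + q ^+ 6 * J 42) - e 1%N * (q ^+ 2 * J 66 + q ^+ 20 * J 6))).
Proof.
have T01 : has_sum (theta false 1 (fun l => X false l)) _ :=
  @theta_J false 1 1 2 84 (fun l => X false l) 3 20 6 erefl ltac:(move=> n /=; ring) isT ltac:(by [left|right]) erefl.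
have T02 : has_sum (theta false (- 2) (fun l => X false l)) _ :=
  @theta_J false (- 2) 0 1 24 (fun l => X false l) 1 2 66 erefl ltac:(move=> n /=; ring) isT ltac:(by [left|right]) erefl.
have S0 : has_sum _ _ := @bailey_rep false 1 (- 2) (fun m => schur q 0 1 (2 * m)) _ _ (fun m => schur_rep2_sum q0 q1 false (2 * m)) T01 T02.
have T11 : has_sum (theta true 1 (fun l => X true l)) _ :=
  @theta_J true 1 0 0 12 (fun l => X true l) 0 0 78 erefl ltac:(move=> n /=; ring) isT ltac:(by [left|right]) erefl.
have T12 : has_sum (theta true (- 2) (fun l => X true l)) _ :=
  @theta_J true (- 2) (- 1) (- 1) (- 48) (fun l => X true l) 2 6 42 erefl ltac:(move=> n /=; ring) isT ltac:(by [left|right]) erefl.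
have S1 : has_sum _ _ := @bailey_rep true 1 (- 2) (fun m => schur q 1 0 (2 * m)) _ _ (fun m => schur_rep2_sum q0 q1 true (2 * m)) T11 T12.
apply: has_sum_eq (has_sumD (has_sumZ (e 1%N) S0) (has_sumZ (e 0%N) S1)) _ _ => [m|]; last by move: (@Ja R) (bailey_const q) => F k; ring.
by rewrite (schur_decomp (2 * m) eS); ring.
Qed.

Lemma schur_rep3_sum_double (a : bool) m :
  has_sum (schur_rep3 q a (2 * m))
    (if m is k.+1 then (1 - Q ^+ (2 * m)) * schur q a%:R (~~ a)%:R (2 * k).+1 else 0).
Proof.
case: m => [|k]; first exact: schur_rep3_sum0.
by rewrite (_ : (2 * k.+1 = (2 * k).+2)%N) ?mulnS //; exact: schur_rep3_sum.
Qed.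

(** The factor 1 - Q^(2m) turns 1/(Q;Q)_(2m) into 1/(Q;Q)_(2m-1), the denominator met when the odd
    indices j = 2m - 1 survive. *)
Lemma schur_value3 : has_sum (fun m => w m / qpoch Q Q (2 * m) * (if m is k.+1 then (1 - Q ^+ (2 * m)) * e (2 * k).+1 else 0))
  (K * (q ^+ 2 * (e 1%N * (- J 74 + q ^+ 8 * J 34) + e 0%N * (q ^+ 6 * J 38 + q ^+ 20 * J 2)))).
Proof.
have T01 : has_sum (theta false 2 (fun l => X false l)) _ :=
  @theta_J false 2 0 (- 1) (- 16) (fun l => X false l) 1 2 74 erefl ltac:(move=> n /=; ring) isT ltac:(by [left|right]) erefl.
have T02 : has_sum (theta false (- 3) (fun l => X false l)) _ :=
  @theta_J false (- 3) (- 1) (- 1) (- 56) (fun l => X false l) 2 10 34 erefl ltac:(move=> n /=; ring) isT ltac:(by [left|right]) erefl.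
have S0 : has_sum _ _ := @bailey_rep false 2 (- 3) (fun m => if m is k.+1 then (1 - Q ^+ (2 * m)) * schur q 0 1 (2 * k).+1 else 0) _ _ (fun m => schur_rep3_sum_double false m) T01 T02.
have T11 : has_sum (theta true 2 (fun l => X true l)) _ :=
  @theta_J true 2 (- 1) (- 3) (- 88) (fun l => X true l) 4 22 2 erefl ltac:(move=> n /=; ring) isT ltac:(by [left|right]) erefl.
have T12 : has_sum (theta true (- 3) (fun l => X true l)) _ :=
  @theta_J true (- 3) 0 2 52 (fun l => X true l) 2 8 38 erefl ltac:(move=> n /=; ring) isT ltac:(by [left|right]) erefl.
have S1 : has_sum _ _ := @bailey_rep true 2 (- 3) (fun m => if m is k.+1 then (1 - Q ^+ (2 * m)) * schur q 1 0 (2 * k).+1 else 0) _ _ (fun m => schur_rep3_sum_double true m) T11 T12.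
apply: has_sum_eq (has_sumD (has_sumZ (e 1%N) S0) (has_sumZ (e 0%N) S1)) _ _ => [m|]; last by move: (@Ja R) (bailey_const q) => F k; ring.
by case: m => [|m]; rewrite ?mulr0 ?addr0 // (schur_decomp (2 * m).+1 eS); ring.
Qed.

Lemma schur_value4 : has_sum (fun m => w m / qpoch Q Q (2 * m) * (Q ^+ m * e (2 * m)%N))
  (K * (- (e 1%N * (q ^+ 6 * J 46 + q ^+ 12 * J 26) - e 0%N * (J 82 + q ^+ 2 * J 62)))).
Proof.
have T01 : has_sum (theta false 1 (fun l => X false l + (2 - 2 * (false : nat)%:Z - 10 * l))) _ :=
  @theta_J false 1 1 2 64 (fun l => X false l + (2 - 2 * (false : nat)%:Z - 10 * l)) 3 12 26 erefl ltac:(move=> n /=; ring) isT ltac:(by [left|right]) erefl.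
have T02 : has_sum (theta false (- 2) (fun l => X false l + (4 + 2 * (false : nat)%:Z + 10 * l))) _ :=
  @theta_J false (- 2) 0 1 44 (fun l => X false l + (4 + 2 * (false : nat)%:Z + 10 * l)) 1 6 46 erefl ltac:(move=> n /=; ring) isT ltac:(by [left|right]) erefl.
have S0 := bailey_rep4 T01 T02.
have T11 : has_sum (theta true 1 (fun l => X true l + (2 - 2 * (true : nat)%:Z - 10 * l))) _ :=
  @theta_J true 1 0 0 (- 8) (fun l => X true l + (2 - 2 * (true : nat)%:Z - 10 * l)) 0 0 82 erefl ltac:(move=> n /=; ring) isT ltac:(by [left|right]) erefl.
have T12 : has_sum (theta true (- 2) (fun l => X true l + (4 + 2 * (true : nat)%:Z + 10 * l))) _ :=
  @theta_J true (- 2) (- 1) (- 1) (- 28) (fun l => X true l + (4 + 2 * (true : nat)%:Z + 10 * l)) 2 2 62 erefl ltac:(move=> n /=; ring) isT ltac:(by [left|right]) erefl.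
have S1 := bailey_rep4 T11 T12.
apply: has_sum_eq (has_sumD (has_sumZ (e 1%N) S0) (has_sumZ (e 0%N) S1)) _ _ => [m|]; last by move: (@Ja R) (bailey_const q) => F k; ring.
by rewrite (schur_decomp (2 * m) eS) /=; ring.
Qed.

End Values.
End ThetaEvaluations.

(** * The triple sum *)

Section TripleSum.
Context {R : realType} (q : R[i]).
Hypotheses (q0 : q != 0) (q1 : `|q| < 1).
Local Notation C := R[i].
Local Notation Q := (q ^+ 4).
Local Notation w := (bailey_weight q).
Local Notation P := (qpoch Q Q).

Let Q1 : `|Q| < 1. Proof. exact: norm_pow_lt1. Qed.
Let P0 n : P n != 0. Proof. exact: qpochqq_neq0. Qed.

Definition nahm_exp (al be ga i j k : int) : int :=
  i * i + 2 * j * j + 2 * k * k - 2 * i * j - 2 * j * k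
  + 2 * al * i + 2 * (be - al) * j + 2 * (ga - be) * k.

(* [u = q^(2 al)], [u v = q^(2 be)] and [u v w = q^(2 ga)]; the four sums of the
   theorem have [(al, be, ga)] equal to (0,0,0), (1,0,0), (1,1,0) and (1,1,1). *)
Definition nahm_term (al be ga : int) (x : nat * nat * nat) : C :=
  q ^ nahm_exp al be ga x.1.1 x.1.2 x.2 / (P x.1.1 * P x.1.2 * P x.2).

Lemma expr_bin4 m : Q ^+ 'C(m, 2) = (q ^+ 2) ^ (m%:Z * m%:Z - m%:Z).
Proof. by rewrite -expr_bin2 ?expf_neq0 // -!exprM; congr (_ ^+ _); lia. Qed.

Variables al be ga : int.
Local Notation tau := (nahm_term al be ga).

(** The bounded factor chi covers at once all parity indicators and signs inserted below. *)
Lemma abs_nahm_term (chi : nat * nat * nat -> C) :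
  (forall x, `|chi x| <= 1) -> abs_summable (fun x => chi x * tau x).
Proof.
move=> chi1; have [K K0 HK] := qpochqq_inv_bounded Q1.
have g c := abs_summable_gauss (q ^ (2 * c)) q1.
pose h (x : nat * nat * nat) : int * int * int :=
  (x.1.1%:Z - x.1.2%:Z, x.1.2%:Z - x.2%:Z, x.2%:Z).
have hI : injective h by move=> [[i j] k] [[i' j'] k'] [] /=; intros; congr (_, _, _); lia.
have := abs_summable_inj hI (abs_summable_prod (abs_summable_prod (g al) (g be)) (g ga)).
apply: (abs_summable_le (k := K * K * K)) => -[[i j] k] /=.
rewrite !exprz_exp -!expfzDr // (_ : _ + _ = nahm_exp al be ga i j k); last by rewrite /nahm_exp; ring.
apply: le_trans (_ : `|tau (i, j, k)| <= _); first by rewrite normrM ler_piMl.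
rewrite /nahm_term /= normrM mulrC ler_wpM2r // !invfM !normrM.
by rewrite !ler_pM // ?mulr_ge0.
Qed.

Lemma nahm_sum_k i j :
  has_sum (fun k : nat => (-1) ^+ k * tau (i, j, k))
    (q ^ nahm_exp al be ga i j 0 / (P i * P j) * qpoch_inf (q ^ (2 + 2 * (ga - be) - 2 * j%:Z)) Q).
Proof.
apply: has_sum_ext (has_sumZ _ (euler (q ^ (2 + 2 * (ga - be) - 2 * j%:Z)) Q1)) => k.
rewrite /nahm_term /= expr_bin4.
rewrite (_ : q ^ nahm_exp al be ga i j k = q ^ nahm_exp al be ga i j 0 *
  (q ^+ 2) ^ (k%:Z * k%:Z - k%:Z) * (q ^ (2 + 2 * (ga - be) - 2 * j%:Z)) ^+ k).
  by field; rewrite !P0.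
by rewrite !exprnP !exprz_exp -!expfzDr //; congr (_ ^ _); rewrite /nahm_exp; ring.
Qed.

Lemma nahm_sum_j i k :
  has_sum (fun j : nat => (-1) ^+ j * tau (i, j, k))
    (q ^ nahm_exp al be ga i 0 k / (P i * P k)
     * qpoch_inf (q ^ (2 + 2 * (be - al) - 2 * (i%:Z + k%:Z))) Q).
Proof.
apply: has_sum_ext (has_sumZ _ (euler (q ^ (2 + 2 * (be - al) - 2 * (i%:Z + k%:Z))) Q1)) => j.
rewrite /nahm_term /= expr_bin4.
rewrite (_ : q ^ nahm_exp al be ga i j k = q ^ nahm_exp al be ga i 0 k *
  (q ^+ 2) ^ (j%:Z * j%:Z - j%:Z) * (q ^ (2 + 2 * (be - al) - 2 * (i%:Z + k%:Z))) ^+ j).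
  by field; rewrite !P0.
by rewrite !exprnP !exprz_exp -!expfzDr //; congr (_ ^ _); rewrite /nahm_exp; ring.
Qed.

(** The factor of index -z/4 is 1 - q^z q^(-z) = 0. *)
Lemma qpoch_inf_neg_eq0 (z : int) : (z %% 4 = 0)%Z -> z <= 0 -> qpoch_inf (q ^ z) Q = 0.
Proof.
move=> z4 z0; apply: (qpoch_inf_eq0 (n := `|(z %/ 4)%Z|%N) Q1).
by rewrite -exprM exprnP -expfzDr // -[RHS](expr0z q); congr (_ ^ _); lia.
Qed.

(** A linear relation between parity classes: for i of parity p and j of parity r, the classes of
    even and of odd k have equal sums. *)
Lemma nahm_vanish_k (p r : bool) : (forall j : nat, odd j = r ->
    qpoch_inf (q ^ (2 + 2 * (ga - be) - 2 * j%:Z)) Q = 0) ->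
  has_sum (fun x => (odd x.1.1 == p)%:R * (odd x.1.2 == r)%:R * (-1) ^+ x.2 * tau x) 0.
Proof.
move=> H0; pose chi (x : nat * nat * nat) : C := (odd x.1.1 == p)%:R * (odd x.1.2 == r)%:R * (-1) ^+ x.2.
have [s Hs] : exists s, has_sum (fun x => chi x * tau x) s.
  apply: abs_has_sum; apply: abs_nahm_term => x; rewrite /chi !normrM normrX normrN1 expr1n mulr1.
  by case: eqP; case: eqP; rewrite ?normr1 ?normr0 ?mulr1 ?mulr0.
suff s0 : s = 0 by rewrite s0 in Hs.
apply: has_sum_unique (has_sum_pair (g := fun=> 0) Hs _) has_sum0 => -[i j].
rewrite [X in has_sum _ X]/=; case: (boolP (odd j == r)) => [/eqP jr|jr].
  have := has_sumZ (odd i == p)%:R (nahm_sum_k i j); rewrite H0 // !mulr0.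
  by apply: has_sum_ext => k; rewrite /chi /= jr eqxx mulr1 mulrA.
by apply: has_sum_ext has_sum0 => k; rewrite /chi /= (negPf jr) mulr0 !mul0r.
Qed.

Lemma nahm_vanish_j (p r : bool) : (forall i k : nat, odd i = p -> odd k = r ->
    qpoch_inf (q ^ (2 + 2 * (be - al) - 2 * (i%:Z + k%:Z))) Q = 0) ->
  has_sum (fun x => (odd x.1.1 == p)%:R * (odd x.2 == r)%:R * (-1) ^+ x.1.2 * tau x) 0.
Proof.
move=> H0; pose chi (x : nat * nat * nat) : C := (odd x.1.1 == p)%:R * (odd x.2 == r)%:R * (-1) ^+ x.1.2.
have [s Hs] : exists s, has_sum (fun x => chi x * tau x) s.
  apply: abs_has_sum; apply: abs_nahm_term => x; rewrite /chi !normrM normrX normrN1 expr1n mulr1.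
  by case: eqP; case: eqP; rewrite ?normr1 ?normr0 ?mulr1 ?mulr0.
suff s0 : s = 0 by rewrite s0 in Hs.
have swapK : cancel (fun x : nat * nat * nat => (x.1.1, x.2, x.1.2)) (fun x => (x.1.1, x.2, x.1.2)).
  by move=> [[i j] k].
have {}Hs := has_sum_bij swapK swapK Hs.
apply: has_sum_unique (has_sum_pair (g := fun=> 0) Hs _) has_sum0 => -[i k]; rewrite [X in has_sum _ X]/=.
case: (boolP ((odd i == p) && (odd k == r))) => [/andP[/eqP ip /eqP kr]|ipkr].
  have := nahm_sum_j i k; rewrite H0 // mulr0.
  by apply: has_sum_ext => j; rewrite /chi /= ip kr !eqxx !mul1r.
apply: has_sum_ext has_sum0 => j; rewrite /chi /=; move: ipkr.
by case: eqP; case: eqP; rewrite ?mulr0 ?mul0r.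
Qed.

(** The order of summation is k, then i, then j: the sum over k leaves a product depending on j
    alone, so the sum over i can be done separately and only j remains. *)
Lemma nahm_reduce (p : bool) (D : nat -> C) :
  (forall j : nat, has_sum (fun i : nat => (odd i == p)%:R *
     (q ^ (i%:Z * i%:Z - 2 * i%:Z * j%:Z + 2 * al * i%:Z) / P i)) (D j)) ->
  exists2 s, has_sum (fun x => (odd x.1.1 == p)%:R * (-1) ^+ x.2 * tau x) s &
   has_sum (fun j : nat => q ^ (2 * j%:Z * j%:Z + 2 * (be - al) * j%:Z) / P j *
      qpoch_inf (q ^ (2 + 2 * (ga - be) - 2 * j%:Z)) Q * D j) s.
Proof.
move=> HD; pose chi (x : nat * nat * nat) : C := (odd x.1.1 == p)%:R * (-1) ^+ x.2.
have [s Hs] : exists s, has_sum (fun x => chi x * tau x) s.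
  apply: abs_has_sum; apply: abs_nahm_term => x; rewrite /chi !normrM normrX normrN1 expr1n mulr1.
  by case: eqP; rewrite ?normr1 ?normr0.
exists s => //.
have Hij : has_sum (fun y : nat * nat => (odd y.1 == p)%:R *
   (q ^ nahm_exp al be ga y.1 y.2 0 / (P y.1 * P y.2) *
    qpoch_inf (q ^ (2 + 2 * (ga - be) - 2 * y.2%:Z)) Q)) s.
  apply: (has_sum_pair Hs) => -[i j]; apply: has_sum_ext (has_sumZ _ (nahm_sum_k i j)) => k.
  by rewrite /chi /= mulrA.
have swapK : cancel (fun x : nat * nat => (x.2, x.1)) (fun x => (x.2, x.1)) by move=> [].
apply: (has_sum_pair (has_sum_bij swapK swapK Hij)) => j.
apply: has_sum_ext (has_sumZ _ (HD j)) => i /=.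
rewrite (_ : q ^ nahm_exp al be ga i j 0 = q ^ (i%:Z * i%:Z - 2 * i%:Z * j%:Z + 2 * al * i%:Z) *
   q ^ (2 * j%:Z * j%:Z + 2 * (be - al) * j%:Z)).
  by field; rewrite !P0.
by rewrite -expfzDr //; congr (_ ^ _); rewrite /nahm_exp; ring.
Qed.

End TripleSum.

(** * Rogers series *)

Section NahmValues.
Context {R : realType} (q : R[i]).
Hypotheses (q0 : q != 0) (q1 : `|q| < 1).
Local Notation C := R[i].
Local Notation Q := (q ^+ 4).
Local Notation w := (bailey_weight q).
Local Notation P := (qpoch Q Q).

Let Q1 : `|Q| < 1. Proof. exact: norm_pow_lt1. Qed.
Let P0 n : P n != 0. Proof. exact: qpochqq_neq0. Qed.

(** It is the parity of i + n, not of i, that is fixed: the shifts of i and n in the recurrence then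
    stay within one family. *)
Definition rogers_term (k : bool) (n i : nat) : C :=
  (odd (i + n) == ~~ k)%:R * (q ^ ((i%:Z + 1 - n%:Z) * (i%:Z + 1 - n%:Z)) / P i).

(* [rogers_seq k 0] and [rogers_seq k 1] are the paper's B_k and A_k at q^4, up to q^k. *)
Definition rogers_seq (k : bool) (n : nat) : C := csum (rogers_term k n).

Lemma rogers_has_sum k n : has_sum (rogers_term k n) (rogers_seq k n).
Proof.
apply: abs_has_csum; have [K K0 HK] := qpochqq_inv_bounded Q1.
have hI : injective (fun i : nat => i%:Z + 1 - n%:Z) by move=> i j; lia.
apply: (abs_summable_le (k := K) _ (abs_summable_inj hI (abs_summable_gauss 1 q1))) => i.
rewrite exp1rz mulr1 normrM; set y := q ^ _.
apply: le_trans (_ : `|y / P i| <= _).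
  by rewrite ler_piMl //; case: eqP; rewrite ?normr1 ?normr0.
by rewrite normrM mulrC ler_wpM2r.
Qed.

(** Since (i+1-n)^2 - (i-1-n)^2 = 4(i-n), the i-th term of E_(n+2) - Q^n E_n contains 1 - Q^i, which
    cancels the last factor of (Q;Q)_i; replacing i by i + 1 gives E_(n+1). *)
Lemma rogers_rec k n : rogers_seq k n.+2 = rogers_seq k n.+1 + Q ^+ n * rogers_seq k n.
Proof.
apply/eqP; rewrite -subr_eq; apply/eqP.
apply: has_sum_unique (has_sumB (rogers_has_sum k n.+2) (has_sumZ (Q ^+ n) (rogers_has_sum k n))) _.
apply/(has_sum_inj _ succn_inj).
  case=> [_|i /(_ i)//]; rewrite /rogers_term !addnS [odd _.+2]/= negbK.
  rewrite (_ : q ^ ((0%N%:Z + 1 - n.+2%:Z) * (0%N%:Z + 1 - n.+2%:Z)) =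
    Q ^+ n * q ^ ((0%N%:Z + 1 - n%:Z) * (0%N%:Z + 1 - n%:Z))); last first.
    by rewrite -exprM exprnP -expfzDr //; congr (_ ^ _); lia.
  by ring.
apply: has_sum_ext (rogers_has_sum k n.+1) => i; rewrite /rogers_term.
rewrite !addnS !addSn /= !negbK qpochSr -exprS.
set b := _%:R; have Qi : 1 - Q ^+ i.+1 != 0 by rewrite one_sub_neq0 // norm_pow_lt1.
rewrite (_ : q ^ ((i.+1%:Z + 1 - n%:Z) * (i.+1%:Z + 1 - n%:Z)) =
  q ^ ((i%:Z + 1 - n.+1%:Z) * (i%:Z + 1 - n.+1%:Z)) * Q ^+ i.+1 / Q ^+ n); last first.
  by rewrite -!exprM !exprnP invr_expz -!expfzDr //; congr (_ ^ _); lia.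
rewrite (_ : i.+1%:Z + 1 - n.+2%:Z = i%:Z + 1 - n.+1%:Z); last by lia.
by field; rewrite P0 Qi !expf_neq0.
Qed.

Lemma rogers_term_reindex (k e : bool) n (f : nat -> C) :
  (forall i, odd (i + n) == ~~ k -> odd i = e) ->
  (forall m : nat, q ^+ k * f m = rogers_term k n (2 * m + e)) ->
  rogers_seq k n = q ^+ k * csum f.
Proof.
move=> He Hf.
have h : injective (fun m : nat => (2 * m + e)%N) by move=> m m'; lia.
have H : has_sum (fun m : nat => rogers_term k n (2 * m + e)) (rogers_seq k n).
  apply/(has_sum_inj _ h); last exact: rogers_has_sum.
  move=> i Hi; rewrite /rogers_term; case: eqP => [/eqP /He ie|]; last by rewrite mul0r.
  by case: (Hi i./2); rewrite -ie mul2n addnC odd_double_half.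
have qk : q ^+ k != 0 by rewrite expf_neq0.
have : has_sum f ((q ^+ k)^-1 * rogers_seq k n).
  by apply: has_sum_ext (has_sumZ (q ^+ k)^-1 H) => m; rewrite -Hf mulKf.
by move=> /has_sum_series ->; rewrite mulVKf.
Qed.

Lemma rogers_seq0 (k : bool) : rogers_seq k 0 = q ^+ k * calB k Q.
Proof.
case: k => /=.
  apply: (@rogers_term_reindex true false) => [i|m]; first by rewrite addn0 => /eqP.
  rewrite /rogers_term (_ : odd (2 * m + false + 0) = false) /=; last by lia.
rewrite mul1r expr1 mulrA addn0.
  by rewrite -exprM -exprS exprnP; congr (_ ^ _ / _); lia.
apply: (@rogers_term_reindex false true) => [i|m]; first by rewrite addn0 => /eqP.
rewrite /rogers_term (_ : odd (2 * m + true + 0) = true) /=; last by lia.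
rewrite !mul1r.
by rewrite -exprM exprnP; congr (_ ^ _ / _); lia.
Qed.

Lemma rogers_seq1 (k : bool) : rogers_seq k 1 = q ^+ k * calA k Q.
Proof.
case: k => /=.
  apply: (@rogers_term_reindex true true) => [i|m]; first by rewrite addn1 /= => /eqP/negbFE.
  rewrite /rogers_term (_ : odd (2 * m + true + 1) = false) /=; last by lia.
rewrite mul1r expr1 mulrA.
  by rewrite -exprM -exprS exprnP; congr (_ ^ _ / _); lia.
apply: (@rogers_term_reindex false false) => [i|m]; first by rewrite addn1 /= => /eqP/negbTE.
rewrite /rogers_term (_ : odd (2 * m + false + 1) = true) /=; last by lia.
rewrite !mul1r addn0.
by rewrite -exprM exprnP; congr (_ ^ _ / _); lia.
Qed.

(** Each of the m leading factors is 1 - q^(-t) = -q^(-t) (1 - q^t) with t = 2, 6, ..., 4m - 2. This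
    is the source of the sign and of (q^2;Q)_m in [bailey_weight]. *)
Lemma qpoch_inf_descend m : qpoch_inf (q ^ (2 - 4 * m%:Z)) Q =
  (-1) ^+ m * q ^ (- (2 * m%:Z * m%:Z)) * qpoch (q ^+ 2) Q m * qpoch_inf (q ^+ 2) Q.
Proof.
elim: m => [|m IHm].
  rewrite (_ : 2 - 4 * 0%N%:Z = 2%N%:Z) // (_ : - (2 * 0%N%:Z * 0%N%:Z) = 0) //.
  by rewrite qpoch0 expr0z expr0 !mul1r exprnP.
rewrite (qpoch_infD _ 1) // qpochSr qpoch0 mul1r expr0 mulr1 expr1.
rewrite (_ : q ^ (2 - 4 * m.+1%:Z) * Q = q ^ (2 - 4 * m%:Z)); last first.
  by rewrite exprnP -expfzDr //; congr (_ ^ _); lia.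
rewrite IHm qpochSr (_ : q ^ (2 - 4 * m.+1%:Z) = (q ^ (4 * m%:Z + 2))^-1); last first.
  by rewrite invr_expz; congr (_ ^ _); lia.
rewrite (_ : q ^ (- (2 * m.+1%:Z * m.+1%:Z)) = q ^ (- (2 * m%:Z * m%:Z)) / q ^ (4 * m%:Z + 2)).
  rewrite (_ : q ^+ 2 * Q ^+ m = q ^ (4 * m%:Z + 2)).
    by rewrite (exprS (-1)); field; rewrite expfz_neq0.
  by rewrite -exprM -exprD exprnP; congr (_ ^ _); lia.
by rewrite invr_expz -expfzDr //; congr (_ ^ _); lia.
Qed.

(** Splitting even and odd factors gives J_2 = (q^2;Q)_inf J_4, and the left side is (q^2;Q)_inf^2 /
    J_4. *)
Lemma bailey_const_J : qpoch_inf (q ^+ 2) Q * bailey_const q = J 2 q ^+ 2 / J 4 q ^+ 3.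
Proof.
have q21 : `|q ^+ 2| < 1 by exact: norm_pow_lt1.
rewrite /J; have -> : qpoch_inf (q ^+ 2) (q ^+ 2) = qpoch_inf (q ^+ 2) Q * qpoch_inf Q Q.
  have E n : qpoch (q ^+ 2) (q ^+ 2) (2 * n) = qpoch (q ^+ 2) Q n * qpoch Q Q n.
    elim: n => [|n IHn]; first by rewrite !qpoch0 mulr1.
    rewrite mulnS !qpochSr IHn -!exprM -!exprD; set a := qpoch _ _ n; set b := qpoch _ _ n.
    rewrite (_ : 2 + 2 * (2 * n) = 2 + 4 * n)%N; last by lia.
    rewrite (_ : 2 + 2 * (1 + 2 * n) = 4 + 4 * n)%N; last by lia.
    by ring.
  have H1 : ((fun n => qpoch (q ^+ 2) (q ^+ 2) (2 * n) : R[i]^o) @ \oo -->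
      (qpoch_inf (q ^+ 2) (q ^+ 2) : R[i]^o))%classic.
    apply/cvgrPdist_le => e e0.
    have /cvgrPdist_le/(_ _ e0)[N _ HN] := cvg_qpoch (a := q ^+ 2) q21.
    by exists N => // n /= Nn; apply: HN => /=; lia.
  have H2 : ((fun n => qpoch (q ^+ 2) Q n * qpoch Q Q n : R[i]^o) @ \oo -->
      (qpoch_inf (q ^+ 2) Q * qpoch_inf Q Q : R[i]^o))%classic.
    by apply: (@cvgM _ _ _ _ (qpoch (q ^+ 2) Q) (qpoch Q Q)); exact: cvg_qpoch.
  move: H2; rewrite -(funext E) => H2.
  exact: (@cvg_unique R[i]^o _ _ _ _ _ H1 H2).
by rewrite /bailey_const; field; exact: qpoch_inf_qq_neq0.
Qed.

(** Completing the square, i^2 - 2ij + 2 al i = (i + 1 - n)^2 - (j - al)^2 with n = j + 1 - al. As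
    al is at most 1, the truncated subtraction giving n is exact. *)
Definition nahm_row (p al : bool) (j : nat) : C :=
  q ^ (- ((j%:Z - (al : nat)%:Z) * (j%:Z - (al : nat)%:Z))) *
  rogers_seq (~~ (p (+) odd (j.+1 - al))) (j.+1 - al).

Lemma nahm_row_sum (p al : bool) (j : nat) :
  has_sum (fun i : nat => (odd i == p)%:R *
     (q ^ (i%:Z * i%:Z - 2 * i%:Z * j%:Z + 2 * (al : nat)%:Z * i%:Z) / P i)) (nahm_row p al j).
Proof.
apply: has_sum_ext (has_sumZ _ (rogers_has_sum _ _)) => i.
rewrite /rogers_term negbK oddD (_ : (odd i (+) _ == _) = (odd i == p)); last first.
  by case: (odd i); case: (odd _); case: (p).
rewrite mulrCA; congr (_ * _); rewrite mulrA -expfzDr //; congr (_ ^ _ / _).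
by case: al => /=; lia.
Qed.

End NahmValues.

(** * The signed sums with i of fixed parity, one for each of the four cases *)

Section NahmTheta.
Context {R : realType} (q : R[i]).
Hypotheses (q0 : q != 0) (q1 : `|q| < 1).
Local Notation C := R[i].
Local Notation Q := (q ^+ 4).
Local Notation w := (bailey_weight q).
Local Notation P := (qpoch Q Q).
Local Notation rseq := (rogers_seq q).

Let Q1 : `|Q| < 1. Proof. exact: norm_pow_lt1. Qed.
Let P0 n : P n != 0. Proof. exact: qpochqq_neq0. Qed.

Lemma nahm_value1 (k : bool) :
  has_sum (fun x => (odd x.1.1 == k)%:R * (-1) ^+ x.2 * nahm_term q 0 0 0 x) (calF 1 k q).
Proof.
have [s Hs Hj] := nahm_reduce q0 q1 0 0 (nahm_row_sum q0 q1 k false).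
suff <- : s = calF 1 k q by [].
have I2 : injective (fun m : nat => (2 * m)%N) by move=> m m'; lia.
have Hm := (has_sum_inj s I2 _).2.
have {}Hm := Hm _ _ Hj.
have V := has_sumZ (qpoch_inf (q ^+ 2) Q) (schur_value1 q0 q1 (rogers_rec q0 q1 k)).
rewrite (has_sum_unique (Hm _) (has_sum_ext _ V)) => [||m].
- rewrite mulrA bailey_const_J // /calF (rogers_seq0 q0 q1) (rogers_seq1 q0 q1) -exprnP.
  by move: (@Ja R) (@J R) (@calA R) (@calB R) => F G A B; ring.
- move=> j jE; have oj : odd j.
    by apply: contraT => /negPf oj; case: (jE j./2); rewrite mul2n -[LHS]odd_double_half oj.
  by rewrite qpoch_inf_neg_eq0 ?mulr0 ?mul0r //; lia.
rewrite /nahm_row subn0 (_ : ~~ _ = k); last by rewrite oddS oddM; case: (k).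
rewrite (_ : 2 + 2 * (0 - 0) - 2 * (2 * m)%N%:Z = 2 - 4 * m%:Z); last by lia.
rewrite qpoch_inf_descend // /w.
rewrite (_ : q ^+ (2 * m ^ 2) = q ^ (2 * (2 * m)%N%:Z * (2 * m)%N%:Z + 2 * (0 - 0) * (2 * m)%N%:Z)
   * q ^ (- (2 * m%:Z * m%:Z)) * q ^ (- (((2 * m)%N%:Z - (false : nat)%:Z) * ((2 * m)%N%:Z - (false : nat)%:Z)))).
  by ring.
by rewrite exprnP -!expfzDr //; congr (_ ^ _); lia.
Qed.

Lemma exprz_pred (k : nat) : q ^ (k%:Z - 1) = q ^+ k / q.
Proof. by rewrite expfzDr // exprnP. Qed.

Lemma nahm_value2 (k : bool) :
  has_sum (fun x => (odd x.1.1 == ~~ k)%:R * (-1) ^+ x.2 * nahm_term q 1 0 0 x) (calF 2 k q).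
Proof.
have [s Hs Hj] := nahm_reduce q0 q1 0 0 (nahm_row_sum q0 q1 (~~ k) true).
suff <- : s = calF 2 k q by [].
have I2 : injective (fun m : nat => (2 * m)%N) by move=> m m'; lia.
have Hm := (has_sum_inj s I2 _).2.
have {}Hm := Hm _ _ Hj.
have V := has_sumZ (qpoch_inf (q ^+ 2) Q / q) (schur_value2 q0 q1 (rogers_rec q0 q1 k)).
rewrite (has_sum_unique (Hm _) (has_sum_ext _ V)) => [||m].
- rewrite mulrAC mulrA bailey_const_J // /calF exprz_pred (rogers_seq0 q0 q1) (rogers_seq1 q0 q1).
  by move: (@Ja R) (@J R) (@calA R) (@calB R) => F G A B; ring.
- move=> j jE; have oj : odd j.
    by apply: contraT => /negPf oj; case: (jE j./2); rewrite mul2n -[LHS]odd_double_half oj.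
  by rewrite qpoch_inf_neg_eq0 ?mulr0 ?mul0r //; lia.
rewrite /nahm_row subn1 /= (_ : ~~ _ = k); last by rewrite oddM; case: (k).
rewrite (_ : 2 + 2 * (0 - 0) - 2 * (2 * m)%N%:Z = 2 - 4 * m%:Z); last by lia.
rewrite qpoch_inf_descend // /w.
rewrite (_ : q ^+ (2 * m ^ 2) = q * q ^ (2 * (2 * m)%N%:Z * (2 * m)%N%:Z + 2 * (0 - (true : nat)%:Z) * (2 * m)%N%:Z)
   * q ^ (- (2 * m%:Z * m%:Z)) * q ^ (- (((2 * m)%N%:Z - (true : nat)%:Z) * ((2 * m)%N%:Z - (true : nat)%:Z)))).
  by field; rewrite q0 P0.
by rewrite exprnP -{2}[q]expr1z -!expfzDr //; congr (_ ^ _); lia.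
Qed.

(** The sum is the opposite of [calF 4]; this sign is undone in the final assembly. *)
Lemma nahm_value4 (k : bool) :
  has_sum (fun x => (odd x.1.1 == ~~ k)%:R * (-1) ^+ x.2 * nahm_term q 1 1 1 x) (- calF 4 k q).
Proof.
have [s Hs Hj] := nahm_reduce q0 q1 1 1 (nahm_row_sum q0 q1 (~~ k) true).
suff <- : s = - calF 4 k q by [].
have I2 : injective (fun m : nat => (2 * m)%N) by move=> m m'; lia.
have Hm := (has_sum_inj s I2 _).2.
have {}Hm := Hm _ _ Hj.
have V := has_sumZ (qpoch_inf (q ^+ 2) Q / q) (schur_value4 q0 q1 (rogers_rec q0 q1 k)).
rewrite (has_sum_unique (Hm _) (has_sum_ext _ V)) => [||m].
- rewrite mulrAC mulrA bailey_const_J // /calF exprz_pred (rogers_seq0 q0 q1) (rogers_seq1 q0 q1).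
  by move: (@Ja R) (@J R) (@calA R) (@calB R) => F G A B; ring.
- move=> j jE; have oj : odd j.
    by apply: contraT => /negPf oj; case: (jE j./2); rewrite mul2n -[LHS]odd_double_half oj.
  by rewrite qpoch_inf_neg_eq0 ?mulr0 ?mul0r //; lia.
rewrite /nahm_row subn1 /= (_ : ~~ _ = k); last by rewrite oddM; case: (k).
rewrite (_ : 2 + 2 * (1 - 1) - 2 * (2 * m)%N%:Z = 2 - 4 * m%:Z); last by lia.
rewrite qpoch_inf_descend // /w.
have -> : q ^ (2 * (2 * m)%N%:Z * (2 * m)%N%:Z + 2 * (1 - (true : nat)%:Z) * (2 * m)%N%:Z) =
   q ^+ (2 * m ^ 2) * Q ^+ m / q / q ^ (- (2 * m%:Z * m%:Z)) /
    q ^ (- (((2 * m)%N%:Z - (true : nat)%:Z) * ((2 * m)%N%:Z - (true : nat)%:Z))).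
  have qV : q^-1 = q ^ (- 1) by rewrite -invr_expz expr1z.
  by rewrite qV -!exprM !exprnP !invr_expz -!expfzDr //; congr (_ ^ _); lia.
by field; rewrite q0 P0 !expfz_neq0.
Qed.

Lemma nahm_value3 (k : bool) :
  has_sum (fun x => (odd x.1.1 == k)%:R * (-1) ^+ x.2 * nahm_term q 1 1 0 x) (calF 3 k q).
Proof.
have [s Hs Hj] := nahm_reduce q0 q1 1 0 (nahm_row_sum q0 q1 k true).
suff <- : s = calF 3 k q by [].
(* In this case the even j are killed, and j = 2m + 1 corresponds to index m + 1 of the Bailey sum;
   its term of index 0 vanishes and is dropped. *)
have I2 : injective (fun m : nat => (2 * m).+1) by move=> m m'; lia.
have Hm := (has_sum_inj s I2 _).2.
have {}Hm := Hm _ _ Hj.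
have V := has_sumZ (qpoch_inf (q ^+ 2) Q / q ^+ 2) (schur_value3 q0 q1 (rogers_rec q0 q1 k)).
have {}V := (has_sum_inj _ succn_inj _).2 V.
rewrite (has_sum_unique (Hm _) (has_sum_ext _ (V _))) => [||m|].
- rewrite mulrAC (mulrA (qpoch_inf (q ^+ 2) Q)) bailey_const_J // /calF -exprnP (rogers_seq0 q0 q1) (rogers_seq1 q0 q1).
  by move: (J 2 q ^+ 2 / J 4 q ^+ 3) (@Ja R) (@calA R) (@calB R) => c F A B; field.
- move=> j jE; have oj : ~~ odd j.
    by apply/negP => oj; case: (jE j./2); rewrite mul2n -[LHS]odd_double_half oj.
  by rewrite qpoch_inf_neg_eq0 ?mulr0 ?mul0r //; lia.
- rewrite /nahm_row subn1 /= (_ : ~~ _ = k); last by rewrite oddM; case: (k).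
  rewrite (_ : 2 + 2 * (0 - 1) - 2 * (2 * m).+1%:Z = 2 - 4 * m.+1%:Z); last by lia.
  rewrite qpoch_inf_descend // /w.
  have -> : q ^ (2 * (2 * m).+1%:Z * (2 * m).+1%:Z + 2 * (1 - (true : nat)%:Z) * (2 * m).+1%:Z) =
     q ^+ (2 * m.+1 ^ 2) / q ^+ 2 / q ^ (- (2 * m.+1%:Z * m.+1%:Z)) /
      q ^ (- (((2 * m).+1%:Z - (true : nat)%:Z) * ((2 * m).+1%:Z - (true : nat)%:Z))).
    by rewrite !exprnP !invr_expz -!expfzDr //; congr (_ ^ _); lia.
  have -> : P (2 * m.+1) = P (2 * m).+1 * (1 - Q ^+ (2 * m.+1)).
    by rewrite (_ : (2 * m.+1 = (2 * m).+2)%N) ?qpochSr ?exprS //; lia.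
  have Qm : 1 - Q ^+ (2 * m.+1) != 0 by rewrite mulnS one_sub_neq0 // norm_pow_lt1.
  by field; rewrite q0 P0 Qm !expfz_neq0.
- by case=> [_|j /(_ j)//] /=; rewrite !mulr0.
Qed.

End NahmTheta.

(** * Assembly of the parity classes *)

Section ImaginaryUnit.
Context {R : realType}.
Local Notation I := ('i%C : R[i]).

(** A table lookup, so that the powers of i in the eight class identities evaluate by
    computation. *)
Lemma imaginary_pow (e : int) :
  I ^ e = nth 0 [:: 1; I; -1; - I] `|(e %% 4)%Z|%N.
Proof.
have I4 : I ^+ 4 = 1 by rewrite (exprM I 2 2) sqr_i sqrrN expr1n.
have I0 : I != 0 by apply: contra_eq_neq I4 => ->; rewrite expr0n eq_sym oner_eq0.
have -> : I ^ e = I ^ (e %% 4)%Z.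
  have I4z : I ^ 4 = 1 by rewrite -exprnP.
  by rewrite {1}(divz_eq e 4) expfzDr // mulrC [_ * 4]mulrC -exprz_exp I4z exp1rz mulr1.
have : (`|(e %% 4)%Z| < 4)%N by lia.
rewrite (_ : I ^ (e %% 4)%Z = I ^+ `|(e %% 4)%Z|%N); last by rewrite exprnP; congr (_ ^ _); lia.
case: `|(e %% 4)%Z|%N => [|[|[|[|n]]]] //= _; rewrite ?expr0 ?expr1 ?sqr_i //.
by rewrite exprS sqr_i mulrN1.
Qed.

Lemma nahm_exp_parity (al be ga : int) (i j k : nat) :
  I ^ nahm_exp al be ga i j k = I ^ nahm_exp al be ga (odd i : nat) (odd j : nat) (odd k : nat).
Proof.
rewrite !imaginary_pow; congr (nth _ _ `|_|%N).
rewrite -{1}(odd_double_half i) -{1}(odd_double_half j) -{1}(odd_double_half k).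
have E (a x : nat) : Posz (a + x.*2) = a%:Z + 2 * x%:Z by lia.
rewrite !E.
move: (odd i : nat) (odd j : nat) (odd k : nat) i./2 j./2 k./2 => a b c x y z.
rewrite -(modzMDl (a%:Z * x%:Z + x%:Z * x%:Z + 2 * b%:Z * y%:Z + 2 * y%:Z * y%:Z + 2 * c%:Z * z%:Z
  + 2 * z%:Z * z%:Z - a%:Z * y%:Z - x%:Z * b%:Z - 2 * x%:Z * y%:Z - b%:Z * z%:Z - y%:Z * c%:Z
  - 2 * y%:Z * z%:Z + al * x%:Z + (be - al) * y%:Z + (ga - be) * z%:Z) (nahm_exp al be ga a b c)).
by congr (modz _ _); rewrite /nahm_exp; ring.
Qed.

Lemma nahm_term_rot (q : R[i]) (al be ga : int) x :
  nahm_term (I * q) al be ga x = I ^ nahm_exp al be ga x.1.1 x.1.2 x.2 * nahm_term q al be ga x.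
Proof.
rewrite /nahm_term (_ : (I * q) ^+ 4 = q ^+ 4) ?expfzMl ?mulrA //.
by rewrite exprMn (exprM I 2 2) sqr_i sqrrN expr1n mul1r.
Qed.

End ImaginaryUnit.

Section Assembly.
Context {R : realType} (q : R[i]).
Hypotheses (q0 : q != 0) (q1 : `|q| < 1).
Local Notation C := R[i].
Local Notation I := ('i%C : R[i]).

(* [c0], [c1], [d] are the multiples of the vanishing signed sums to be added in order to
   match the coefficient of each of the eight parity classes. *)
Lemma nahm_total (h al be ga : int) (s c0 c1 d W0 W1 W0' W1' : C) (p0 rk sj : bool) :
  let psum (p : bool) q' := has_sum (fun x =>
    (odd x.1.1 == p)%:R * (-1) ^+ x.2 * nahm_term q' al be ga x) in
  psum p0 q W0 -> psum (~~ p0) q W1 ->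
  psum p0 (I * q) W0' -> psum (~~ p0) (I * q) W1' ->
  (forall j : nat, odd j = rk -> (2 + 2 * (ga - be) - 2 * j%:Z <= 0) /\
     ((2 + 2 * (ga - be) - 2 * j%:Z) %% 4 = 0)%Z) ->
  (forall i k : nat, odd k = odd i (+) sj -> (2 + 2 * (be - al) - 2 * (i%:Z + k%:Z) <= 0) /\
     ((2 + 2 * (be - al) - 2 * (i%:Z + k%:Z)) %% 4 = 0)%Z) ->
  (forall a b c : bool, let e := nahm_exp al be ga (a : nat) (b : nat) (c : nat) in
     s * (- ((a == p0)%:R * (-1) ^+ c) + (a == ~~ p0)%:R * (-1) ^+ c
          + 2 * (I ^ (h - 1 + e) * ((a == p0)%:R * (-1) ^+ c)
                 + I ^ (h - 2 + e) * ((a == ~~ p0)%:R * (-1) ^+ c)))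
     + c0 * ((a == false)%:R * (b == rk)%:R * (-1) ^+ c)
     + c1 * ((a == true)%:R * (b == rk)%:R * (-1) ^+ c)
     + d * ((a == false)%:R * (c == false (+) sj)%:R * (-1) ^+ b)
     + d * ((a == true)%:R * (c == true (+) sj)%:R * (-1) ^+ b) = 1) ->
  has_sum (nahm_term q al be ga)
    (s * (- W0 + W1 + 2 * I ^ (h - 2) * (I * W0' + W1'))).
Proof.
move=> psum H0 H1 H0' H1' Hk Hj coef.
have Vk p : has_sum _ 0 := nahm_vanish_k q0 q1 al p (fun j jr =>
  let: conj z0 z4 := Hk j jr in qpoch_inf_neg_eq0 q0 q1 z4 z0).
have Vj p : has_sum (fun x => (odd x.1.1 == p)%:R * (odd x.2 == p (+) sj)%:R * (-1) ^+ x.1.2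
    * nahm_term q al be ga x) 0.
  apply: nahm_vanish_j => // i k ip kp.
  by case: (Hj i k); rewrite ?ip // => z0 z4; apply: qpoch_inf_neg_eq0.
have I0 : I != 0.
  by apply/negP => /eqP/(congr1 (fun z => z ^+ 2)); rewrite sqr_i expr0n /= => /eqP; rewrite oppr_eq0 oner_eq0.
have HF := has_sumD (has_sumD (has_sumN H0) H1)
  (has_sumZ 2 (has_sumD (has_sumZ (I ^ (h - 1)) H0') (has_sumZ (I ^ (h - 2)) H1'))).
have HV := has_sumD (has_sumD (has_sumD (has_sumD (has_sumZ s HF)
  (has_sumZ c0 (Vk false))) (has_sumZ c1 (Vk true))) (has_sumZ d (Vj false))) (has_sumZ d (Vj true)).
apply: has_sum_eq HV _ _ => [x|]; last first.
  rewrite (_ : h - 1 = h - 2 + 1) ?expfzDr ?expr1z //; last by ring.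
  by ring.
rewrite !nahm_term_rot; move: (nahm_term q al be ga x) => t.
have := congr1 (fun z => z * t) (coef (odd x.1.1) (odd x.1.2) (odd x.2)).
rewrite mul1r => /= {}coef; apply: etrans coef.
rewrite nahm_exp_parity !(expfzDr (_ - _)) // !signr_odd.
by ring.
Qed.

Lemma nahmM_sum (al be ga : int) (u v w s : C) :
  u = q ^ (2 * al) -> v = q ^ (2 * (be - al)) -> w = q ^ (2 * (ga - be)) ->
  has_sum (nahm_term q al be ga) s -> nahmM u v w q = s.
Proof.
move=> -> -> -> H; apply: has_sum_sum; apply: has_sum_ext H => -[[i j] k].
rewrite /nahm_term /= !exprnP !exprz_exp -!expfzDr //.
by congr (_ ^ _ / _); rewrite /nahm_exp; ring.
Qed.

End Assembly.

Unset Implicit Arguments.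
Set Strict Implicit.

Theorem theorem1p1 (R : realType) (q : R[i]) (hq0 : 0 < `|q|) (hq1 : `|q| < 1)
    (h : nat) (hh : (1 <= h <= 4)%N) :
  Mh h q =
    - calF h 0 q + calF h 1 q
    + 2 * 'i%C ^ (h%:Z - 2)
        * ('i%C * calF h 0 ('i%C * q) + calF h 1 ('i%C * q)).
Proof.
have q0 : q != 0 by rewrite -normr_gt0.
have I0 : 'i%C != 0 :> R[i] by rewrite eq_complex /= oner_eq0 andbF.
have iq0 : 'i%C * q != 0 by rewrite mulf_neq0.
have iq1 : `|'i%C * q| < 1.
  by rewrite normrM normc_def /= expr0n expr1n add0r sqrtr1 mul1r.
case: h hh => [|[|[|[|[|h]]]]] // _.
(* The multipliers solve the eight class equations. For instance, here the class (even, odd, even)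
   has exponent 2 modulo 4 and reads -1 - 2 + c0 = 1, while (even, even, odd) reads 1 + 2 + d = 1.
   The three booleans are the parity of i attached to F_0, the parity of j at which the sum over k
   vanishes, and the parity of i + k at which the sum over j vanishes. *)
- have := @nahm_total R q q0 hq1 1 0 0 0 1 4 (-4) (-2) _ _ _ _ false true true
    (nahm_value1 q0 hq1 false) (nahm_value1 q0 hq1 true)
    (nahm_value1 iq0 iq1 false) (nahm_value1 iq0 iq1 true).
  rewrite mul1r => H; apply: (@nahmM_sum _ q q0 0 0 0) => //; apply: H.
  + by move=> j; lia.
  + by move=> i k; lia.
  by move=> [] [] [] e; rewrite {}/e !imaginary_pow /=; ring.
- have := @nahm_total R q q0 hq1 2 1 0 0 1 (-4) 4 (-2) _ _ _ _ true true false
    (nahm_value2 q0 hq1 false) (nahm_value2 q0 hq1 true)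
    (nahm_value2 iq0 iq1 false) (nahm_value2 iq0 iq1 true).
  rewrite mul1r => H; apply: (@nahmM_sum _ q q0 1 0 0) => //; apply: H.
  + by move=> j; lia.
  + by move=> i k; lia.
  by move=> [] [] [] e; rewrite {}/e !imaginary_pow /=; ring.
- have := @nahm_total R q q0 hq1 3 1 1 0 1 4 (-4) 2 _ _ _ _ false false true
    (nahm_value3 q0 hq1 false) (nahm_value3 q0 hq1 true)
    (nahm_value3 iq0 iq1 false) (nahm_value3 iq0 iq1 true).
  rewrite mul1r => H; apply: (@nahmM_sum _ q q0 1 1 0) => //; apply: H.
  + by move=> j; lia.
  + by move=> i k; lia.
  by move=> [] [] [] e; rewrite {}/e !imaginary_pow /=; ring.
(* The multiplier s = -1 offsets the sign in [nahm_value4]. *)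
- have := @nahm_total R q q0 hq1 4 1 1 1 (-1) 4 (-4) (-2) _ _ _ _ true true true
    (nahm_value4 q0 hq1 false) (nahm_value4 q0 hq1 true)
    (nahm_value4 iq0 iq1 false) (nahm_value4 iq0 iq1 true).
  move=> H; apply: (@nahmM_sum _ q q0 1 1 1) => //.
  apply: has_sum_eq (H _ _ _) (frefl _) _; last by move: (calF 4) => F; ring.
  + by move=> j; lia.
  + by move=> i k; lia.
  by move=> [] [] [] e; rewrite {}/e !imaginary_pow /=; ring.
Qed.
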